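(* Fix an integer $m\ge1$ and real $A>C>0$. Put $r=\sqrt{\dfrac{C}{A-C}}$. For any $p\in(0,1)$, set $$h=\sqrt{\frac{1-p^2}{1+r^2}},\qquad q=rh,\qquad D=\frac{\sqrt{AC}}{p}.$$ Then $p\neq0$, $q\ne0$, $p^2+q^2<1$, and for the metric $$g=g_{A,C}+g_{S^3}+p(\beta_1\otimes\sigma_1+\sigma_1\otimes\beta_1)+q(\beta_3\otimes\sigma_1+\sigma_1\otimes\beta_3)$$ on $S^{4m-1}\times S^3$ and the one-dimensional foliation generated by $T=u_1$, the mixed curvature operator $R_T$ is positive, parallel along every leaf (that is, $\nabla_T^\perp R_T=0$), and nonscalar. At every point, $$\operatorname{spec}(R_T)=\left\{\frac{AC}{4},\,AC\right\},$$ where $AC$ is simple and $AC/4$ has multiplicity $4m$.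
   Context: Notation. Let $g_0$ be the round metric of curvature $1$ on the unit sphere $S^{4m-1}\subset\mathbb H^m$, with $\xi_1(x)=xi$, $\xi_2(x)=xj$, $\xi_3(x)=xk$ and $\eta_\alpha=g_0(\xi_\alpha,\cdot)$. Put $L=2/\sqrt{AC}$, $M=2/A$, $g_{A,C}=L^2g_0+(M^2-L^2)\eta_2\otimes\eta_2$. The fields $u_1=\frac{\sqrt{AC}}2\xi_1$, $u_2=\frac A2\xi_2$, $u_3=\frac{\sqrt{AC}}2\xi_3$ are $g_{A,C}$-orthonormal and satisfy $[u_1,u_2]=Au_3$, $[u_2,u_3]=Au_1$, $[u_3,u_1]=Cu_2$; put $\beta_\alpha=g_{A,C}(u_\alpha,\cdot)$. Identify $S^3$ with the group $Sp(1)$ of unit quaternions, with the bi-invariant metric $g_{S^3}$ for which the left-invariant frame $v_1,v_2,v_3$, whose values at the identity are positive multiples of $i,j,k$ respectively, is orthonormal and satisfies $[v_1,v_2]=Dv_3$, $[v_2,v_3]=Dv_1$, $[v_3,v_1]=Dv_2$; put $\sigma_1=g_{S^3}(v_1,\cdot)$. Fields, forms and metrics on the factors are pulled back to $S^{4m-1}\times S^3$ without change of notation. The foliation generated by the $g$-unit field $T=u_1$ is totally geodesic ($\nabla_TT=0$). The mixed curvature operator is $R_T:T^\perp\to T^\perp$, $R_T(U)=R(U,T)T$, where $R(X,Y)Z=\nabla_X\nabla_YZ-\nabla_Y\nabla_XZ-\nabla_{[X,Y]}Z$ for the Levi-Civita connection of $g$. The normal derivative is $(\nabla_T^\perp R_T)U=\nabla_T^\perp(R_TU)-R_T(\nabla_T^\perp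 U)$, where $\nabla_T^\perp U$ is the component of $\nabla_TU$ orthogonal to $T$. Nonscalar means not a multiple of the identity. *)

(* Defs.v *)
From HB Require Import structures.
From mathcomp Require Import all_boot all_order all_algebra.
From mathcomp Require Import all_classical all_reals all_analysis.

Set Implicit Arguments.
Unset Strict Implicit.
Unset Printing Implicit Defensive.

Import Order.TTheory GRing.Theory Num.Theory.
Import numFieldNormedType.Exports.

Local Open Scope ring_scope.

(* A quaternion a + b i + c j + d k is the row vector (a, b, c, d); an element
   of H^m is an m x 4 matrix whose rows are its m quaternionic coordinates. *)
Definition quat (R : realType) (a b c d : R) : 'rV[R]_4 :=
  \row_(s < 4) [:: a; b; c; d]`_s.

Definition qmul (R : realType) (x y : 'rV[R]_4) : 'rV[R]_4 :=
  let a (s : 'I_4) := x 0 s in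
  let b (s : 'I_4) := y 0 s in
  quat (a 0 * b 0 - a 1 * b 1 - a 2%:R * b 2%:R - a 3%:R * b 3%:R)
       (a 0 * b 1 + a 1 * b 0 + a 2%:R * b 3%:R - a 3%:R * b 2%:R)
       (a 0 * b 2%:R - a 1 * b 3%:R + a 2%:R * b 0 + a 3%:R * b 1)
       (a 0 * b 3%:R + a 1 * b 2%:R - a 2%:R * b 1 + a 3%:R * b 0).

Definition qi (R : realType) : 'rV[R]_4 := quat 0 1 0 0.
Definition qj (R : realType) : 'rV[R]_4 := quat 0 0 1 0.
Definition qk (R : realType) : 'rV[R]_4 := quat 0 0 0 1.

Definition hmul (R : realType) (m : nat) (x : 'M[R]_(m, 4)) (y : 'rV[R]_4) :
    'M[R]_(m, 4) :=
  \matrix_(s < m) qmul (row s x) y.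

Definition dot (R : realType) (m n : nat) (u v : 'M[R]_(m, n)) : R :=
  \sum_(s < m) \sum_(t < n) u s t * v s t.

(* S^(4m-1) x S^3 is the closed submanifold [on_M] of [ambient R m].  Smooth
   functions and vector fields on it are represented by smooth maps of the
   whole ambient space (such extensions always exist); only values on the
   submanifold, and derivatives there in tangent directions, are ever used. *)
Notation ambient R m := ('M[R]_(m, 4) * 'rV[R]_4)%type.

Fixpoint Ck (R : realType) (V W : normedModType R) (k : nat) (f : V -> W) :
    Prop :=
  if k is k'.+1 then
    (forall x, differentiable f x) /\
    (forall v, Ck k' (fun x => 'd f x v))
  else continuous f.

Definition smooth (R : realType) (V W : normedModType R) (f : V -> W) : Prop :=
  forall k, Ck k f.

Section Geometry.
Context {R : realType} {m : nat}.
Local Notation E := (ambient R m).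

Definition on_M (x : E) : Prop := dot x.1 x.1 = 1 /\ dot x.2 x.2 = 1.

Definition tangent (x u : E) : Prop := dot x.1 u.1 = 0 /\ dot x.2 u.2 = 0.

Definition vector_field (X : E -> E) : Prop :=
  smooth X /\ forall x, on_M x -> tangent x (X x).

Definition lie_bracket (X Y : E -> E) : E -> E :=
  fun x => 'd Y x (X x) - 'd X x (Y x).

Record riemannian_metric (g : E -> E -> E -> R) : Prop := {
  metric_linear : forall x a u v w, on_M x ->
    tangent x u -> tangent x v -> tangent x w ->
    g x (a *: u + v) w = a * g x u w + g x v w;
  metric_sym : forall x u v, on_M x -> tangent x u -> tangent x v ->
    g x u v = g x v u;
  metric_pos : forall x u, on_M x -> tangent x u -> u != 0 -> 0 < g x u u;
  metric_smooth : forall X Y, vector_field X -> vector_field Y ->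
    smooth (fun x => g x (X x) (Y x))
}.

Record levi_civita (g : E -> E -> E -> R)
    (nabla : (E -> E) -> (E -> E) -> (E -> E)) : Prop := {
  nabla_vector_field : forall X Y,
    vector_field X -> vector_field Y -> vector_field (nabla X Y);
  nabla_addl : forall X X' Y x,
    vector_field X -> vector_field X' -> vector_field Y -> on_M x ->
    nabla (fun z => X z + X' z) Y x = nabla X Y x + nabla X' Y x;
  nabla_scalel : forall (f : E -> R) X Y x,
    smooth f -> vector_field X -> vector_field Y -> on_M x ->
    nabla (fun z => f z *: X z) Y x = f x *: nabla X Y x;
  nabla_addr : forall X Y Y' x,
    vector_field X -> vector_field Y -> vector_field Y' -> on_M x ->
    nabla X (fun z => Y z + Y' z) x = nabla X Y x + nabla X Y' x;
  nabla_leibniz : forall (f : E -> R) X Y x,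
    smooth f -> vector_field X -> vector_field Y -> on_M x ->
    nabla X (fun z => f z *: Y z) x =
      'd f x (X x) *: Y x + f x *: nabla X Y x;
  nabla_torsion_free : forall X Y x,
    vector_field X -> vector_field Y -> on_M x ->
    nabla X Y x - nabla Y X x = lie_bracket X Y x;
  nabla_metric : forall X Y Z x,
    vector_field X -> vector_field Y -> vector_field Z -> on_M x ->
    'd (fun z => g z (Y z) (Z z)) x (X x) =
      g x (nabla X Y x) (Z x) + g x (Y x) (nabla X Z x)
}.

Definition curvature (nabla : (E -> E) -> (E -> E) -> (E -> E))
    (X Y Z : E -> E) : E -> E :=
  fun x => nabla X (nabla Y Z) x - nabla Y (nabla X Z) x
           - nabla (lie_bracket X Y) Z x.

Definition mixed_curvature (nabla : (E -> E) -> (E -> E) -> (E -> E))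
    (T U : E -> E) : E -> E :=
  curvature nabla U T T.

Definition normal (g : E -> E -> E -> R) (T : E -> E) (x u : E) : Prop :=
  tangent x u /\ g x u (T x) = 0.

Definition normal_field (g : E -> E -> E -> R) (T U : E -> E) : Prop :=
  vector_field U /\ forall x, on_M x -> normal g T x (U x).

(* The component of nabla_T U orthogonal to T, for T of unit length. *)
Definition normal_nabla (g : E -> E -> E -> R)
    (nabla : (E -> E) -> (E -> E) -> (E -> E)) (T U : E -> E) : E -> E :=
  fun x => nabla T U x - g x (nabla T U x) (T x) *: T x.

Definition normal_derivative (g : E -> E -> E -> R)
    (nabla : (E -> E) -> (E -> E) -> (E -> E)) (T U : E -> E) : E -> E :=
  fun x => normal_nabla g nabla T (mixed_curvature nabla T U) x
           - mixed_curvature nabla T (normal_nabla g nabla T U) x.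

(* K is R_T at the point x; only its restriction to the normal space of T at x
   is constrained.  Every normal vector at x extends to a normal field, so that
   restriction is uniquely determined. *)
Definition mixed_curvature_at (g : E -> E -> E -> R)
    (nabla : (E -> E) -> (E -> E) -> (E -> E)) (T : E -> E) (x : E)
    (K : 'End(E)) : Prop :=
  (forall u, normal g T x u -> normal g T x (K u)) /\
  (forall U, normal_field g T U -> K (U x) = mixed_curvature nabla T U x).

(* For K : 'End(E) preserving a subspace W of E given as a predicate. *)
Definition eigenvalue_on (W : E -> Prop) (K : 'End(E)) (a : R) : Prop :=
  exists u, [/\ W u, u != 0 & K u = a *: u].

Definition eigenspace_dim (W : E -> Prop) (K : 'End(E)) (a : R) (n : nat) :
    Prop :=
  exists V : {vspace E},
    (forall u, u \in V <-> W u /\ K u = a *: u) /\ \dim V = n.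

End Geometry.

Section Sphere.
Context {R : realType} {m : nat}.
Variables A C : R.
Local Notation V := 'M[R]_(m, 4).

Definition xi1 (x : V) : V := hmul x (qi R).
Definition xi2 (x : V) : V := hmul x (qj R).
Definition xi3 (x : V) : V := hmul x (qk R).

Definition eta2 (x v : V) : R := dot (xi2 x) v.

Definition Lc : R := 2 / Num.sqrt (A * C).
Definition Mc : R := 2 / A.

Definition gAC (x v w : V) : R :=
  Lc ^+ 2 * dot v w + (Mc ^+ 2 - Lc ^+ 2) * (eta2 x v * eta2 x w).

Definition u1 (x : V) : V := (Num.sqrt (A * C) / 2) *: xi1 x.
Definition u3 (x : V) : V := (Num.sqrt (A * C) / 2) *: xi3 x.

Definition beta1 (x v : V) : R := gAC x (u1 x) v.
Definition beta3 (x v : V) : R := gAC x (u3 x) v.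
End Sphere.

(* The left-invariant fields s y e, with e = i, j, k and s > 0, have brackets
   [s y i, s y j] = 2 s (s y k), so the structure constant D forces s = D / 2;
   they are then orthonormal for (2 / D)^2 times the Euclidean metric. *)
Section Sp1.
Context {R : realType}.
Variable D : R.

Definition v1 (y : 'rV[R]_4) : 'rV[R]_4 := (D / 2) *: qmul y (qi R).

Definition gS3 (y v w : 'rV[R]_4) : R := (2 / D) ^+ 2 * dot v w.

Definition sigma1 (y v : 'rV[R]_4) : R := gS3 y (v1 y) v.
End Sp1.

Definition g_total {R : realType} {m : nat} (A C p q D : R)
    (x v w : ambient R m) : R :=
  gAC A C x.1 v.1 w.1 + gS3 D x.2 v.2 w.2
  + p * (beta1 A C x.1 v.1 * sigma1 D x.2 w.2
         + sigma1 D x.2 v.2 * beta1 A C x.1 w.1)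
  + q * (beta3 A C x.1 v.1 * sigma1 D x.2 w.2
         + sigma1 D x.2 v.2 * beta3 A C x.1 w.1).

Definition T_field {R : realType} {m : nat} (A C : R) (x : ambient R m) :
    ambient R m :=
  (u1 A C x.1, 0).

(* Main.v *)
(* For a vector field U, nabla_U T is given by a tensor S, read off from the Koszul
   formula, with S T = 0.  As the connection is torsion free and nabla_T T = 0,
   R_T = - L_T S - S^2 with L_T the Lie derivative.  In the left-invariant frame
   u_1, u_2, u_3, v_1, v_2, v_3 this evaluates, for the prescribed q and D, to
     R_T U = (AC/4) U + (3AC/4) g(U, F) F / g(F, F)       (U normal to T)
   with F = r p u_1 + h (1 + r^2) u_3 - r v_1, orthogonal to T.  Moreover
   nabla_T F = 0, whence R_T is parallel. *)
Require Import Defs.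
From HB Require Import structures.
From mathcomp Require Import all_boot all_order all_algebra.
From mathcomp Require Import all_classical all_reals all_analysis.
From mathcomp Require Import ring lra.
Set Implicit Arguments.
Unset Strict Implicit.
Unset Printing Implicit Defensive.
Import Order.TTheory GRing.Theory Num.Theory.
Import numFieldNormedType.Exports.
Local Open Scope ring_scope.

(** Two obstacles shape the proof. Fields are maps of the ambient space, while a connection is
    constrained only on the submanifold; an identity known there, such as nabla_T T = 0, may be
    differentiated only in tangent directions, so each such use needs a locality argument. Second,
    the square roots must go: with s = sqrt (A * C) / 2 the only relation left is p^2 + h^2 (1 +
    r^2) = 1, and modulo it the geometric claims become rational identities between inner products
    of x, of tangent vectors and of their products with i, j, k. T and F are restrictions of linear
    maps of the ambient space, so their flat derivatives are again given by these maps. Origin of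
    the constants: since g([v_2, v_3], T) = p D, the Koszul formula makes S rotate the plane of v_2,
    v_3 with speed p D / 2. The chosen D makes this s, the speed at which S rotates the sphere
    directions orthogonal to xi, xj, xk; there -S^2 is s^2 = AC/4. The number h^2 = 1 - p^2 - q^2 is
    the Gram determinant of u_1, u_3, v_1, and g(F, F) = h^2 (1 + r^2) = 1 - p^2. *)

(** * Calculus of directional derivatives *)

Section DirectionalDerivative.
Context {R : realType} {V : normedModType R}.
Implicit Types W : normedModType R.

(** The differential is a total operator, meaningful only at points of differentiability. Carrying
    both facts together lets the rules below compose, the derivative being computed by
    unification. *)
Definition has_dd {W} (x v : V) (f : V -> W) (w : W) : Prop :=
  differentiable f x /\ 'd f x v = w.

Lemma dd_diff {W} x v (f : V -> W) : differentiable f x -> has_dd x v f ('d f x v).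
Proof. by []. Qed.

Lemma dd_eq {W} x v (f : V -> W) w w' : has_dd x v f w -> w = w' -> has_dd x v f w'.
Proof. by move=> ? <-. Qed.

Lemma dd_cst {W} x v (c : W) : has_dd x v (fun=> c) 0.
Proof. by split; [exact: differentiable_cst|rewrite diff_cst]. Qed.

Lemma dd_id x v : has_dd x v (fun z : V => z) v.
Proof.
have [df e] := @is_diff_id R V x; split=> //.
exact: (congr1 (@^~ v) e).
Qed.

Lemma dd_add {W} x v (f g : V -> W) w1 w2 : has_dd x v f w1 -> has_dd x v g w2 ->
  has_dd x v (fun z => f z + g z) (w1 + w2).
Proof.
move=> [df <-] [dg <-]; split; first exact: differentiableD.
exact: (congr1 (@^~ v) (diffD df dg)).
Qed.

Lemma dd_opp {W} x v (f : V -> W) w :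
  has_dd x v f w -> has_dd x v (fun z => - f z) (- w).
Proof.
move=> [df <-]; split; first exact: differentiableN.
exact: (congr1 (@^~ v) (diffN df)).
Qed.

Lemma dd_sub {W} x v (f g : V -> W) w1 w2 : has_dd x v f w1 -> has_dd x v g w2 ->
  has_dd x v (fun z => f z - g z) (w1 - w2).
Proof. by move=> Hf Hg; apply: dd_add => //; exact: dd_opp. Qed.

Lemma dd_lin {W W'} (L : W -> W') : linear L -> continuous L ->
  forall x v (f : V -> W) w, has_dd x v f w -> has_dd x v (fun z => L (f z)) (L w).
Proof.
move=> Llin Lc x v f w [df <-].
pose LM := GRing.isLinear.Build _ _ _ _ _ Llin.
pose LL : {linear _ -> _} := HB.pack L LM.
have dL : differentiable L (f x) by exact: (@linear_differentiable _ _ _ LL).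
split; first exact: (differentiable_comp df dL).
rewrite [LHS](congr1 (@^~ v) (diff_comp df dL)) /=.
by rewrite [LHS](congr1 (@^~ _) (@diff_lin _ _ _ LL (f x) Lc)).
Qed.

Lemma dd_pair {W W'} x v (f : V -> W) (g : V -> W') w1 w2 :
  has_dd x v f w1 -> has_dd x v g w2 ->
  has_dd x v (fun z => (f z, g z)) (w1, w2).
Proof.
move=> [df <-] [dg <-]; split; first exact: differentiable_pair.
exact: (congr1 (@^~ v) (diff_pair df dg)).
Qed.

Lemma dd_bilin {W1 W2 W'} (B : W1 -> W2 -> W') :
  (forall b, linear (B ^~ b)) -> (forall a, linear (B a)) ->
  continuous (fun q => B q.1 q.2) ->
  forall x v (f : V -> W1) (g : V -> W2) a b, has_dd x v f a -> has_dd x v g b ->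
  has_dd x v (fun z => B (f z) (g z)) (B a (g x) + B (f x) b).
Proof.
move=> Bl Br Bc x v f g a b Hf Hg.
have Bb : bilinear_for (GRing.Scale.Law.clone _ _ *:%R _)
   (GRing.Scale.Law.clone _ _ *:%R _) B.
  by split=> [u'|u] c u1 u2; [exact: Bl|exact: Br].
pose BM := bilinear_isBilinear.Build R W1 W2 W' _ _ B Bb.
pose BB : {bilinear W1 -> W2 -> W'} := HB.pack B BM.
have [dp ep] := dd_pair Hf Hg.
have dB := @differentiable_bilin _ _ _ _ BB (f x, g x) Bc.
split; first exact: (differentiable_comp dp dB).
rewrite [LHS](congr1 (@^~ v) (diff_comp dp dB)) /= ep.
rewrite [LHS](congr1 (@^~ _) (@diff_bilin _ _ _ _ BB (f x, g x) Bc)) /=.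
by rewrite addrC.
Qed.

Lemma dd_mul x v (f g : V -> R) a b : has_dd x v f a -> has_dd x v g b ->
  has_dd x v (fun z => f z * g z) (a * g x + f x * b).
Proof.
apply: (@dd_bilin R R R (fun a b => a * b)) => [c d u w|c d u w|[c d]].
- by rewrite mulrDl -scalerAl.
- by rewrite mulrDr scalerAr.
- exact: mul_continuous.
Qed.

Lemma dd_scale {W} x v (f : V -> R) (g : V -> W) a b :
  has_dd x v f a -> has_dd x v g b ->
  has_dd x v (fun z => f z *: g z) (a *: g x + f x *: b).
Proof.
apply: (@dd_bilin R W W (fun a b => a *: b)) => [c d u w|c d u w|[c d]].
- by rewrite scalerDl scalerA.
- by rewrite scalerDr !scalerA mulrC.
- exact: scale_continuous.
Qed.

Lemma dd_fst {W W'} (y v : V) (X : V -> W * W') a :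
  has_dd y v X a -> has_dd y v (fun z => (X z).1) a.1.
Proof. by apply: (dd_lin (L := fst)) => // z; exact: cvg_fst. Qed.

Lemma dd_snd {W W'} (y v : V) (X : V -> W * W') a :
  has_dd y v X a -> has_dd y v (fun z => (X z).2) a.2.
Proof. by apply: (dd_lin (L := snd)) => // z; exact: cvg_snd. Qed.

End DirectionalDerivative.

Section Chain.
Context {R : realType}.

Lemma dd_comp (U V W : normedModType R) (x v : U) (f : U -> V) (h : V -> W) a b :
  has_dd x v f a -> has_dd (f x) a h b -> has_dd x v (fun z => h (f z)) b.
Proof.
move=> [df <-] [dh <-]; split; first exact: (differentiable_comp df dh).
exact: (congr1 (@^~ v) (diff_comp df dh)).
Qed.

Lemma dd_inv (V : normedModType R) (x v : V) (f : V -> R) a : f x != 0 ->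
  has_dd x v f a -> has_dd x v (fun z => (f z)^-1) (- (f x) ^- 2 * a).
Proof.
move=> fx Hf; apply: (dd_comp Hf); split; first exact: differentiable_Rinv.
by rewrite diff_Rinv.
Qed.

End Chain.

(** * Closure properties of smooth maps *)

Section Smooth.
Context {R : realType} {V : normedModType R}.
Implicit Types W : normedModType R.

Lemma smooth_differentiable {W} (f : V -> W) :
  smooth f -> forall x, differentiable f x.
Proof. by move=> sf; exact: (proj1 (sf 1%N)). Qed.

Lemma smooth_dd {W} (f : V -> W) x v : smooth f -> has_dd x v f ('d f x v).
Proof. by move=> /smooth_differentiable. Qed.

Lemma smooth_diff {W} (f : V -> W) v : smooth f -> smooth (fun x => 'd f x v).
Proof. by move=> sf k; exact: (proj2 (sf k.+1) v). Qed.

Lemma Ck_pred {W} k (f : V -> W) : Ck k.+1 f -> Ck k f.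
Proof.
elim: k f => [|k IH] f /=.
  by move=> [df _] x; exact: differentiable_continuous.
by move=> [df ddf]; split=> // v; exact/IH/ddf.
Qed.

Lemma Ck_cst {W} k (c : W) : Ck k (fun _ : V => c).
Proof.
elim: k c => [|k IH] c /=; first exact: cst_continuous.
split=> [x|v]; first exact: differentiable_cst.
rewrite (_ : (fun _ => _) = fun=> 0) //; apply/funext => x.
by case: (dd_cst x v c).
Qed.

Lemma Ck_lin {W W'} (L : W -> W') : linear L -> continuous L ->
  forall k (f : V -> W), Ck k f -> Ck k (fun z => L (f z)).
Proof.
move=> Ll Lc; elim=> [|k IH] f /=.
  by move=> cf x; apply: continuous_comp; [exact: cf|exact: Lc].
move=> [df ddf]; split=> [x|v].
  by case: (dd_lin Ll Lc (dd_diff 0 (df x))).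
rewrite (_ : (fun _ => _) = fun x => L ('d f x v)); first exact: IH.
by apply/funext => x; case: (dd_lin Ll Lc (dd_diff v (df x))).
Qed.

Lemma CkD {W} k (f g : V -> W) : Ck k f -> Ck k g -> Ck k (fun z => f z + g z).
Proof.
elim: k f g => [|k IH] f g /=.
  by move=> cf cg x; apply: continuousD; [exact: cf|exact: cg].
move=> [df ddf] [dg ddg]; split=> [x|v]; first exact: differentiableD.
rewrite (_ : (fun _ => _) = fun x => 'd f x v + 'd g x v); first exact: IH.
by apply/funext => x; case: (dd_add (dd_diff v (df x)) (dd_diff v (dg x))).
Qed.

(** By the Leibniz rule the derivative is a sum of two terms of the same bilinear shape, one order
    lower; [Ck_pred] lowers the order of the factor left undifferentiated. *)
Lemma Ck_bilin {W1 W2 W'} (B : W1 -> W2 -> W') :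
  (forall b, linear (B ^~ b)) -> (forall a, linear (B a)) ->
  continuous (fun q => B q.1 q.2) ->
  forall k (f : V -> W1) (g : V -> W2), Ck k f -> Ck k g ->
  Ck k (fun z => B (f z) (g z)).
Proof.
move=> Bl Br Bc; elim=> [|k IH] f g.
  move=> cf cg x; have cfg : {for x, continuous (fun z => (f z, g z))}.
    by apply: cvg_pair; [exact: cf|exact: cg].
  exact: (continuous_comp cfg (Bc _)).
move=> Hf Hg; have [df ddf] := Hf; have [dg ddg] := Hg.
have dB x v := dd_bilin Bl Br Bc (dd_diff v (df x)) (dd_diff v (dg x)).
split=> [x|v]; first by case: (dB x 0).
rewrite (_ : (fun _ => _) = fun x => B ('d f x v) (g x) + B (f x) ('d g x v)).
  apply: CkD; apply: IH; [exact: ddf|exact: Ck_pred|exact: Ck_pred|exact: ddg].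
by apply/funext => x; case: (dB x v).
Qed.

Lemma smooth_cst {W} (c : W) : smooth (fun _ : V => c).
Proof. by move=> k; exact: Ck_cst. Qed.

Lemma smooth_lin {W W'} (L : W -> W') (f : V -> W) : linear L -> continuous L ->
  smooth f -> smooth (fun z => L (f z)).
Proof. by move=> Ll Lc sf k; apply: Ck_lin. Qed.

Lemma smooth_id : smooth (fun z : V => z).
Proof.
case=> [|k] /=; first by move=> x; exact: cvg_id.
split=> [x|v]; first by case: (dd_id x 0).
rewrite (_ : (fun _ => _) = fun=> v); first exact: Ck_cst.
by apply/funext => x; case: (dd_id x v).
Qed.

Lemma smooth_add {W} (f g : V -> W) :
  smooth f -> smooth g -> smooth (fun z => f z + g z).
Proof. by move=> sf sg k; apply: CkD. Qed.

Lemma smooth_scale {W} (f : V -> R) (g : V -> W) :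
  smooth f -> smooth g -> smooth (fun z => f z *: g z).
Proof.
move=> sf sg k.
apply: (@Ck_bilin R W W (fun a b => a *: b)) => // [c d u w|c d u w|[c d]].
- by rewrite scalerDl scalerA.
- by rewrite scalerDr !scalerA mulrC.
- exact: scale_continuous.
Qed.

Lemma smooth_mul (f g : V -> R) :
  smooth f -> smooth g -> smooth (fun z => f z * g z).
Proof. exact: (@smooth_scale R). Qed.

Lemma smooth_opp {W} (f : V -> W) : smooth f -> smooth (fun z => - f z).
Proof.
move=> sf; rewrite (_ : (fun z => _) = fun z => (-1) *: f z).
  by apply: smooth_scale => //; exact: smooth_cst.
by apply/funext => z; rewrite scaleN1r.
Qed.

Lemma smooth_sub {W} (f g : V -> W) :
  smooth f -> smooth g -> smooth (fun z => f z - g z).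
Proof. by move=> sf sg; apply: smooth_add => //; exact: smooth_opp. Qed.

Lemma smooth_sum {W} (I : Type) (s : seq I) (f : I -> V -> W) :
  (forall i, smooth (f i)) -> smooth (fun z => \sum_(i <- s) f i z).
Proof.
move=> sf; elim: s => [|i s IH].
  rewrite (_ : (fun _ => _) = fun=> 0); first exact: smooth_cst.
  by apply/funext => z; rewrite big_nil.
rewrite (_ : (fun _ => _) = fun z => f i z + \sum_(j <- s) f j z).
  exact: smooth_add.
by apply/funext => z; rewrite big_cons.
Qed.

Lemma smooth_fst {W W'} (f : V -> W * W') : smooth f -> smooth (fun z => (f z).1).
Proof. by move=> sf; apply: (smooth_lin (L := fst)) => // x; exact: cvg_fst. Qed.

Lemma smooth_snd {W W'} (f : V -> W * W') : smooth f -> smooth (fun z => (f z).2).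
Proof. by move=> sf; apply: (smooth_lin (L := snd)) => // x; exact: cvg_snd. Qed.

Lemma smooth_pair {W W'} (f : V -> W) (g : V -> W') :
  smooth f -> smooth g -> smooth (fun z => (f z, g z)).
Proof.
move=> sf sg; rewrite (_ : (fun _ => _) = fun z => (f z, 0) + (0, g z)).
  apply: smooth_add.
    apply: (smooth_lin (L := fun w => (w, 0))) => // [a u w|u].
      by congr pair; rewrite /= scaler0 add0r.
    by apply: cvg_pair => //; exact: cvg_cst.
  apply: (smooth_lin (L := fun w => (0, w))) => // [a u w|u].
    by congr pair; rewrite /= scaler0 add0r.
  by apply: cvg_pair => //; exact: cvg_cst.
by apply/funext => z; congr pair; rewrite /= ?addr0 ?add0r.
Qed.

End Smooth.

(** * The Euclidean inner product and linear maps on matrices *)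

Section Dot.
Context {R : realType} {m n : nat}.
Implicit Types u v w : 'M[R]_(m, n).

Lemma dotC u v : dot u v = dot v u.
Proof. by rewrite /dot; do 2!apply: eq_bigr => ? _; rewrite mulrC. Qed.

Lemma dotDl u v w : dot (u + v) w = dot u w + dot v w.
Proof.
rewrite /dot -big_split; apply: eq_bigr => i _; rewrite -big_split.
by apply: eq_bigr => j _; rewrite mxE mulrDl.
Qed.

Lemma dotZl a u v : dot (a *: u) v = a * dot u v.
Proof.
rewrite /dot mulr_sumr; apply: eq_bigr => i _; rewrite mulr_sumr.
by apply: eq_bigr => j _; rewrite mxE mulrA.
Qed.

Lemma dotNl u v : dot (- u) v = - dot u v.
Proof. by rewrite -scaleN1r dotZl mulN1r. Qed.

Lemma dot0l u : dot 0 u = 0.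
Proof. by rewrite -(scale0r 0) dotZl mul0r. Qed.

Lemma dotDr u v w : dot u (v + w) = dot u v + dot u w.
Proof. by rewrite dotC dotDl !(dotC u). Qed.

Lemma dotZr a u v : dot u (a *: v) = a * dot u v.
Proof. by rewrite dotC dotZl dotC. Qed.

Lemma dotNr u v : dot u (- v) = - dot u v.
Proof. by rewrite dotC dotNl dotC. Qed.

Lemma dot0r u : dot u 0 = 0.
Proof. by rewrite dotC dot0l. Qed.

Lemma dot_ge0 u : 0 <= dot u u.
Proof. by do 2!apply: sumr_ge0 => ? _; rewrite -expr2 sqr_ge0. Qed.

Lemma dot_eq0 u : (dot u u == 0) = (u == 0).
Proof.
apply/eqP/eqP => [/eqP|->]; last exact: dot0l.
have sq_ge0 i j : 0 <= u i j * u i j by rewrite -expr2 sqr_ge0.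
rewrite psumr_eq0 => [/allP u0|i _]; last exact: sumr_ge0.
apply/matrixP => i j; rewrite mxE.
have := u0 i (mem_index_enum i); rewrite psumr_eq0 // => /allP /(_ j).
by rewrite mem_index_enum -expr2 sqrf_eq0 => /(_ isT) /eqP.
Qed.

End Dot.

Section DotSmooth.
Context {R : realType} {V : normedModType R} {m n : nat}.

Lemma smooth_coord (f : V -> 'M[R]_(m, n)) i j :
  smooth f -> smooth (fun z => f z i j).
Proof.
apply: (smooth_lin (L := fun u : 'M[R]_(m, n) => u i j)) => [a u v|u].
  by rewrite !mxE.
exact: coord_continuous.
Qed.

Lemma smooth_dot (f g : V -> 'M[R]_(m, n)) :
  smooth f -> smooth g -> smooth (fun z => dot (f z) (g z)).
Proof.
move=> sf sg; apply: smooth_sum => i; apply: smooth_sum => j.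
by apply: smooth_mul; exact: smooth_coord.
Qed.

End DotSmooth.

Section FiniteDimension.
Context {R : realType} {m n : nat}.

Lemma mx_linear_smooth (W : normedModType R) (L : 'M[R]_(m, n) -> W) :
  linear L -> smooth L.
Proof.
move=> Ll.
pose LM := GRing.isLinear.Build _ _ _ _ _ Ll.
pose LL : {linear _ -> _} := HB.pack L LM.
rewrite (_ : L = fun u => \sum_i \sum_j u i j *: L (delta_mx i j)).
  apply: smooth_sum => i; apply: smooth_sum => j.
  by apply: smooth_scale; [exact/smooth_coord/smooth_id|exact: smooth_cst].
apply/funext => u; rewrite -[L]/(LL : _ -> _) {1}(matrix_sum_delta u).
rewrite linear_sum; apply: eq_bigr => i _; rewrite linear_sum.
by apply: eq_bigr => j _; rewrite linearZ.
Qed.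

Lemma mx_linear_continuous (W : normedModType R) (L : 'M[R]_(m, n) -> W) :
  linear L -> continuous L.
Proof. by move=> /mx_linear_smooth sL; exact: (sL 0%N). Qed.

Lemma dot_continuous :
  continuous (fun q : 'M[R]_(m, n) * 'M[R]_(m, n) => dot q.1 q.2).
Proof.
have smooth_pr := @smooth_id R ('M[R]_(m, n) * 'M[R]_(m, n))%type.
exact: (smooth_dot (smooth_fst smooth_pr) (smooth_snd smooth_pr) 0%N).
Qed.

Lemma dd_dot (V : normedModType R) x v (f g : V -> 'M[R]_(m, n)) a b :
  has_dd x v f a -> has_dd x v g b ->
  has_dd x v (fun z => dot (f z) (g z)) (dot a (g x) + dot (f x) b).
Proof.
apply: dd_bilin => [c d u w|c d u w|]; last exact: dot_continuous.
- by rewrite dotDl dotZl.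
- by rewrite dotDr dotZr.
Qed.

End FiniteDimension.

(** * Curves on spheres and locality of tangential derivatives *)

Section Sphere.
Context {R : realType} {m n : nat}.

(** The curve is inverse stereographic projection from -x of the line t v / 2. It is rational in t,
    and its norm is 1 because (1 - k t^2)^2 + 4 k t^2 = (1 + k t^2)^2 with k = |v|^2 / 4. *)
Lemma sphere_curve (x v : 'M[R]_(m, n)) : dot x x = 1 -> dot x v = 0 ->
  exists c : R -> 'M[R]_(m, n),
    [/\ c 0 = x, has_dd (0 : R) (1 : R) c v & forall t, dot (c t) (c t) = 1].
Proof.
move=> xx xv; pose k := dot v v / 4; have k0 : 0 <= k.
  by apply: divr_ge0; [exact: dot_ge0|].
exists (fun t => (1 + t * t * k)^-1 *: ((1 - t * t * k) *: x + t *: v)).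
have d1 : has_dd (0 : R) (1 : R) (fun t : R => t * t * k) 0.
  apply: dd_eq; [apply: dd_mul; [apply: dd_mul; exact: dd_id|exact: dd_cst]|].
  by rewrite !(mul0r, mulr0, addr0).
split.
- by rewrite !mul0r addr0 subr0 invr1 !scale1r scale0r addr0.
- apply: dd_eq.
    apply: dd_scale; first apply: dd_inv.
    + by rewrite !mul0r addr0 oner_neq0.
    + by apply: dd_add; [exact: dd_cst|exact: d1].
    + apply: dd_add; last by apply: dd_scale; [exact: dd_id|exact: dd_cst].
      apply: dd_scale; last exact: dd_cst.
      by apply: dd_sub; [exact: dd_cst|exact: d1].
  by rewrite !(mul0r, mulr0, scale0r, oppr0, addr0, add0r, scaler0, invr1, scale1r).
- move=> t; have den : 1 + t * t * k != 0.
    by rewrite gt_eqF // ltr_pwDl // mulr_ge0 // -expr2 sqr_ge0.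
  rewrite !(dotZl, dotZr, dotDl, dotDr) (dotC v x) xx xv.
  rewrite (_ : dot v v = 4 * k); last by rewrite /k; field.
  by field.
Qed.

End Sphere.

Section Locality.
Context {R : realType} {m : nat}.
Local Notation E := (ambient R m).

(** Both derivatives are read along one curve that stays on the submanifold, where the two maps
    coincide. This makes the choice of ambient extensions harmless. *)
Lemma dd_on_M (W : normedModType R) (f g : E -> W) x v a b :
  (forall z, on_M z -> f z = g z) -> on_M x -> tangent x v ->
  has_dd x v f a -> has_dd x v g b -> a = b.
Proof.
case: x v => x1 x2 [v1 v2] fg [/= xx1 xx2] [/= xv1 xv2] Hf Hg.
have [c1 [c10 dc1 cc1]] := sphere_curve xx1 xv1.
have [c2 [c20 dc2 cc2]] := sphere_curve xx2 xv2.
have dc := dd_pair dc1 dc2.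
have [_ <-] : has_dd (0 : R) (1 : R) (fun t => f (c1 t, c2 t)) a.
  by apply: (dd_comp dc); rewrite c10 c20.
have [_ <-] : has_dd (0 : R) (1 : R) (fun t => g (c1 t, c2 t)) b.
  by apply: (dd_comp dc); rewrite c10 c20.
congr ('d _ _ _); apply/funext => t; apply: fg; split; [exact: cc1|exact: cc2].
Qed.

End Locality.

Local Notation "x ·i" := (hmul x (qi _))
  (at level 1, left associativity, format "x ·i").
Local Notation "x ·j" := (hmul x (qj _))
  (at level 1, left associativity, format "x ·j").
Local Notation "x ·k" := (hmul x (qk _))
  (at level 1, left associativity, format "x ·k").

(** * Right multiplication by quaternion units *)

Section Quaternions.
Context {R : realType} {m : nat}.
Implicit Types x y a b : 'M[R]_(m, 4).

Lemma quatE (a b c d : R) : (quat a b c d 0 0 = a) * (quat a b c d 0 1 = b) *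
  (quat a b c d 0 2%:R = c) * (quat a b c d 0 3%:R = d).
Proof. by rewrite !mxE. Qed.

Lemma ord4P (P : 'I_4 -> Prop) : P 0 -> P 1 -> P 2%:R -> P 3%:R -> forall t, P t.
Proof.
by move=> P0 P1 P2 P3 [[|[|[|[|//]]]] lt];
  [move: P0|move: P1|move: P2|move: P3]; congr P; exact: val_inj.
Qed.

Lemma hmulE x (a b c d : R) s :
  (hmul x (quat a b c d) s 0 =
   x s 0 * a - x s 1 * b - x s 2%:R * c - x s 3%:R * d) *
  (hmul x (quat a b c d) s 1 =
   x s 0 * b + x s 1 * a + x s 2%:R * d - x s 3%:R * c) *
  (hmul x (quat a b c d) s 2%:R =
   x s 0 * c - x s 1 * d + x s 2%:R * a + x s 3%:R * b) *
  (hmul x (quat a b c d) s 3%:R =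
   x s 0 * d + x s 1 * c - x s 2%:R * b + x s 3%:R * a).
Proof.
have row_s t : row s x 0 t = x s t by rewrite mxE.
by do 3?split; rewrite mxE /qmul !row_s !quatE.
Qed.

Lemma hmulD x y q : hmul (x + y) q = hmul x q + hmul y q.
Proof.
have -> : q = quat (q 0 0) (q 0 1) (q 0 2%:R) (q 0 3%:R).
  by apply/rowP; elim/ord4P; rewrite quatE.
by apply/matrixP => s; elim/ord4P; rewrite [RHS]mxE !hmulE !mxE; ring.
Qed.

Lemma hmulZ c x q : hmul (c *: x) q = c *: hmul x q.
Proof.
have -> : q = quat (q 0 0) (q 0 1) (q 0 2%:R) (q 0 3%:R).
  by apply/rowP; elim/ord4P; rewrite quatE.
by apply/matrixP => s; elim/ord4P; rewrite [RHS]mxE !hmulE !mxE; ring.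
Qed.

Lemma hmul_linear q : linear (fun x => hmul x q).
Proof. by move=> c x y; rewrite hmulD hmulZ. Qed.

Lemma hmulN x q : hmul (- x) q = - hmul x q.
Proof. by rewrite -scaleN1r hmulZ scaleN1r. Qed.

Lemma hmul0 q : hmul (0 : 'M[R]_(m, 4)) q = 0.
Proof. by rewrite -[X in hmul X _](scale0r 0) hmulZ scale0r. Qed.

Lemma hmul_continuous q : continuous (fun x => hmul x q).
Proof. exact/mx_linear_continuous/hmul_linear. Qed.

Lemma hmul_units x :
  ((x·i)·i = - x) * ((x·i)·j = x·k) * ((x·i)·k = - x·j) *
  ((x·j)·i = - x·k) * ((x·j)·j = - x) * ((x·j)·k = x·i) *
  ((x·k)·i = x·j) * ((x·k)·j = - x·i) * ((x·k)·k = - x).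
Proof.
have oppE (u : 'M[R]_(m, 4)) s t : (- u) s t = - u s t by rewrite mxE.
by do 8?split; apply/matrixP => s; elim/ord4P; rewrite ?oppE !hmulE; ring.
Qed.

Lemma dot4 x y : dot x y = \sum_(s < m)
  (x s 0 * y s 0 + x s 1 * y s 1 + x s 2%:R * y s 2%:R + x s 3%:R * y s 3%:R).
Proof.
apply: eq_bigr => s _; rewrite !big_ord_recl big_ord0 addr0 !addrA.
by congr (_ + _ + _ + _); congr (x s _ * y s _); exact: val_inj.
Qed.

Lemma dot_hmul_skew x y :
  (dot (x·i) y = - dot x (y·i)) * (dot (x·j) y = - dot x (y·j)) *
  (dot (x·k) y = - dot x (y·k)).
Proof.
by do 2?split; rewrite !dot4 -sumrN; apply: eq_bigr => s _; rewrite !hmulE; ring.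
Qed.

Lemma dot_hmul_flip x y :
  (dot x y·i = - dot y x·i) * (dot x y·j = - dot y x·j) *
  (dot x y·k = - dot y x·k).
Proof. by do 2?split; rewrite (dotC x) dot_hmul_skew. Qed.

Lemma dot_hmul_self x : (dot x x·i = 0) * (dot x x·j = 0) * (dot x x·k = 0).
Proof.
by have [[e1 e2] e3] := dot_hmul_flip x x; do 2?split; lra.
Qed.

End Quaternions.

Lemma qmul_hmul (R : realType) (y q : 'rV[R]_4) : qmul y q = hmul y q.
Proof. by apply/rowP => t; rewrite [RHS]mxE row_id. Qed.

Section QuaternionSmooth.
Context {R : realType} {V : normedModType R} {m : nat}.

Lemma dd_hmul (y v : V) (X : V -> 'M[R]_(m, 4)) a b :
  has_dd y v X a -> has_dd y v (fun z => hmul (X z) b) (hmul a b).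
Proof.
exact (@dd_lin _ _ _ _ (fun c => hmul c b) (hmul_linear b)
  (@hmul_continuous _ _ b) y v X a).
Qed.

Lemma smooth_hmul (X : V -> 'M[R]_(m, 4)) b :
  smooth X -> smooth (fun z => hmul (X z) b).
Proof.
exact (@smooth_lin _ _ _ _ (fun c => hmul c b) X (hmul_linear b)
  (@hmul_continuous _ _ b)).
Qed.

End QuaternionSmooth.

Definition dot_lin R m n := (@dotDl R m n, @dotDr R m n, @dotZl R m n,
  @dotZr R m n, @dotNl R m n, @dotNr R m n, @dot0l R m n, @dot0r R m n).

Definition hmul_lin R m :=
  (@hmulD R m, @hmulZ R m, @hmulN R m, @hmul0 R m, @hmul_units R m).

(* [mxE] itself would also unfold the entries of [hmul]. *)
Lemma zeromxE (R : nmodType) m n i j : (0 : 'M[R]_(m, n)) i j = 0.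
Proof. by rewrite mxE. Qed.

Lemma addmxE (R : nmodType) m n (A B : 'M[R]_(m, n)) i j :
  (A + B) i j = A i j + B i j.
Proof. by rewrite mxE. Qed.

Lemma oppmxE (R : zmodType) m n (A : 'M[R]_(m, n)) i j : (- A) i j = - A i j.
Proof. by rewrite mxE. Qed.

Lemma scalemxE (R : pzRingType) m n c (A : 'M[R]_(m, n)) i j :
  (c *: A) i j = c * A i j.
Proof. by rewrite mxE. Qed.

Definition mx_lin (R : pzRingType) m n :=
  (@addmxE R m n, @oppmxE R m n, @scalemxE R m n, @zeromxE R m n).

Lemma pairP (X Y : Type) (c d : X * Y) : c.1 = d.1 -> c.2 = d.2 -> c = d.
Proof. by case: c d => ? ? [? ?] /= -> ->. Qed.

(* All inner products become sums of terms [dot a b] and [dot a (b q)] with [q]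
   a single quaternion unit. *)
Ltac normalize := rewrite /= ?hmul_lin ?dot_lin ?dot_hmul_skew ?hmul_lin ?dot_lin
  ?dot_hmul_self.

(** * Vector fields on the product of spheres *)

Section VectorFields.
Context {R : realType} {m : nat}.
Local Notation E := (ambient R m).
Implicit Types (x u v : E) (X Y Z : E -> E) (f : E -> R).

Lemma tangentD x u v : tangent x u -> tangent x v -> tangent x (u + v).
Proof. by move=> [u1 u2] [v1 v2]; split; rewrite dotDr ?u1 ?u2 ?v1 ?v2 addr0. Qed.

Lemma tangentZ x a u : tangent x u -> tangent x (a *: u).
Proof. by move=> [u1 u2]; split; rewrite dotZr ?u1 ?u2 mulr0. Qed.

Lemma tangentB x u v : tangent x u -> tangent x v -> tangent x (u - v).
Proof.
by move=> tu tv; rewrite -scaleN1r; apply: tangentD => //; exact: tangentZ.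
Qed.

Lemma vector_fieldD X Y : vector_field X -> vector_field Y ->
  vector_field (fun z => X z + Y z).
Proof.
move=> [sX tX] [sY tY]; split; first exact: smooth_add.
by move=> x Mx; apply: tangentD; [exact: tX|exact: tY].
Qed.

Lemma vector_fieldZ f X : smooth f -> vector_field X ->
  vector_field (fun z => f z *: X z).
Proof.
move=> sf [sX tX]; split; first exact: smooth_scale.
by move=> x Mx; exact/tangentZ/tX.
Qed.

Lemma vector_fieldB X Y : vector_field X -> vector_field Y ->
  vector_field (fun z => X z - Y z).
Proof.
move=> [sX tX] [sY tY]; split; first exact: smooth_sub.
by move=> x Mx; apply: tangentB; [exact: tX|exact: tY].
Qed.

(** On the submanifold this is the Euclidean projection of the constant field v to the tangent
    space. It supplies the test fields that turn the Koszul formula into a statement about single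
    vectors. *)
Definition tangent_extension v : E -> E :=
  fun z => (v.1 - dot z.1 v.1 *: z.1, v.2 - dot z.2 v.2 *: z.2).

Lemma tangent_extension_vf v : vector_field (tangent_extension v).
Proof.
have s1 := smooth_fst (@smooth_id R E); have s2 := smooth_snd (@smooth_id R E).
split=> [|x [x1 x2]].
  by apply: smooth_pair; (apply: smooth_sub; first exact: smooth_cst);
    apply: smooth_scale => //; apply: smooth_dot => //; exact: smooth_cst.
by split; rewrite /= dotDr dotNr dotZr ?x1 ?x2 mulr1 subrr.
Qed.

Lemma tangent_extensionE v x : tangent x v -> tangent_extension v x = v.
Proof.
case: v => v1 v2 [/= e1 e2].
by rewrite /tangent_extension /= e1 e2 !scale0r !subr0.
Qed.

(** [Ck] controls derivatives in constant directions only, so the varying direction is expanded in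
    the standard basis, with smooth coefficients. *)
Lemma smooth_diff_along (W : normedModType R) (f : E -> W) X :
  smooth f -> smooth X -> smooth (fun x => 'd f x (X x)).
Proof.
move=> sf sX.
have s1 := smooth_fst sX; have s2 := smooth_snd sX.
rewrite (_ : (fun _ => _) = fun x =>
  \sum_i \sum_j ((X x).1 i j *: 'd f x ((delta_mx i j, 0) : E)) +
  \sum_i \sum_j ((X x).2 i j *: 'd f x ((0, delta_mx i j) : E))).
  apply: smooth_add; apply: smooth_sum => i; apply: smooth_sum => j;
    by apply: smooth_scale; [exact: smooth_coord|exact: smooth_diff].
apply/funext => x; move: (X x) => [u1 u2] /=.
have -> : (u1, u2) = \sum_i \sum_j u1 i j *: ((delta_mx i j, 0) : E) +
    \sum_i \sum_j u2 i j *: ((0, delta_mx i j) : E).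
  pose i1 (a : 'M[R]_(m, 4)) : E := (a, 0).
  pose i2 (a : 'rV[R]_4) : E := (0, a).
  have i1D : {morph i1 : a b / a + b} by move=> a b; congr pair; rewrite /= addr0.
  have i2D : {morph i2 : a b / a + b} by move=> a b; congr pair; rewrite /= addr0.
  have -> : (u1, u2) = i1 u1 + i2 u2 by congr pair; rewrite /= ?addr0 ?add0r.
  rewrite {1}(matrix_sum_delta u1) {1}(matrix_sum_delta u2).
  rewrite (big_morph i1 i1D (erefl (0 : E))) (big_morph i2 i2D (erefl (0 : E))).
  congr (_ + _); apply: eq_bigr => i _.
    rewrite (big_morph i1 i1D (erefl (0 : E))); apply: eq_bigr => j _.
    by congr pair; rewrite /= scaler0.
  rewrite (big_morph i2 i2D (erefl (0 : E))); apply: eq_bigr => j _.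
  by congr pair; rewrite /= scaler0.
rewrite linearD !linear_sum; congr (_ + _); apply: eq_bigr => i _;
  by rewrite linear_sum; apply: eq_bigr => j _; rewrite linearZ.
Qed.

End VectorFields.

(** * The Koszul formula in ambient coordinates and its consequences *)

Section Koszul.
Context {R : realType} {m : nat}.
Local Notation E := (ambient R m).
Implicit Types (x u v : E) (X Y Z : E -> E).
Variables (g : E -> E -> E -> R) (dg : E -> E -> E -> E -> R).
Hypothesis g_linear : forall x w, linear (fun u => g x u w : R^o).
Hypothesis g_sym : forall x u v, g x u v = g x v u.
Hypothesis g_pos : forall x u, on_M x -> u != 0 -> 0 < g x u u.
Hypothesis g_dd : forall x v X Y a b, has_dd x v X a -> has_dd x v Y b ->
  has_dd x v (fun z => g z (X z) (Y z))
    (dg x v (X x) (Y x) + (g x a (Y x) + g x (X x) b)).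

Lemma bilDl x u v w : g x (u + v) w = g x u w + g x v w.
Proof. by have := g_linear x w 1 u v; rewrite !scale1r. Qed.

Lemma bilZl x a u w : g x (a *: u) w = a * g x u w.
Proof.
have g0 : g x 0 w = 0 by apply: (addrI (g x 0 w)); rewrite -bilDl !addr0.
by have := g_linear x w a u 0; rewrite g0 !addr0.
Qed.

Lemma bilNl x u w : g x (- u) w = - g x u w.
Proof. by rewrite -scaleN1r bilZl mulN1r. Qed.

Lemma bilBl x u v w : g x (u - v) w = g x u w - g x v w.
Proof. by rewrite bilDl bilNl. Qed.

Lemma metric_nondegenerate x u v : on_M x -> tangent x u -> tangent x v ->
  (forall w, tangent x w -> g x u w = g x v w) -> u = v.
Proof.
move=> Mx tu tv uv; apply/eqP; rewrite -subr_eq0; apply/negPn/negP => /(g_pos Mx).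
by rewrite bilDl bilNl uv ?subrr ?ltxx //; exact: tangentB.
Qed.

Variable nabla : (E -> E) -> (E -> E) -> (E -> E).
Hypothesis LC : levi_civita g nabla.

Let koszul_arith (nXY nYX nXZ nXZ' nZX nYZ nYZ' nZY nZY'
    dYX dXY dZX dZX' dXZ dZY dZY' dYZ dYZ' gX gY gZ : R) :
  gX + (dYX + dZX') = nXY + nXZ' -> gY + (dXY + dZY') = nYX + nYZ' ->
  gZ + (dXZ + dYZ') = nZX + nZY' -> nXY - nYX = dYX - dXY ->
  nXZ - nZX = dZX - dXZ -> nYZ - nZY = dZY - dYZ ->
  dZX' = dZX -> dZY' = dZY -> dYZ' = dYZ -> nXZ' = nXZ -> nYZ' = nYZ ->
  nZY' = nZY -> 2 * nXY = 2 * dYX + gX + gY - gZ.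
Proof. by lra. Qed.

(** Torsion freeness turns brackets into flat ambient derivatives, and all of these except the one
    of Y along X cancel. What survives is the Christoffel formula, with [dg] the derivative of the
    coefficients of g; the flat derivative itself may fail to be tangent. *)
Lemma koszul X Y Z x :
  vector_field X -> vector_field Y -> vector_field Z -> on_M x ->
  2 * g x (nabla X Y x) (Z x) =
  2 * g x ('d Y x (X x)) (Z x) + dg x (X x) (Y x) (Z x) + dg x (Y x) (X x) (Z x)
  - dg x (Z x) (X x) (Y x).
Proof.
move=> vX vY vZ Mx.
have dX v := smooth_dd x v vX.1; have dY v := smooth_dd x v vY.1.
have dZ v := smooth_dd x v vZ.1.
have tor X' Y' w (vX' : vector_field X') (vY' : vector_field Y') :
    g x (nabla X' Y' x) w - g x (nabla Y' X' x) w =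
    g x ('d Y' x (X' x)) w - g x ('d X' x (Y' x)) w.
  by apply: etrans (bilBl _ _ _ _); apply: etrans (esym (bilBl _ _ _ _)) _;
    rewrite (nabla_torsion_free LC).
apply: koszul_arith
  (etrans (esym (g_dd (dY (X x)) (dZ (X x))).2) (nabla_metric LC vX vY vZ Mx))
  (etrans (esym (g_dd (dX (Y x)) (dZ (Y x))).2) (nabla_metric LC vY vX vZ Mx))
  (etrans (esym (g_dd (dX (Z x)) (dY (Z x))).2) (nabla_metric LC vZ vX vY Mx))
  (tor _ _ (Z x) vX vY) (tor _ _ (Y x) vX vZ) (tor _ _ (X x) vY vZ)
  (g_sym _ _ _) (g_sym _ _ _) (g_sym _ _ _)
  (g_sym _ _ _) (g_sym _ _ _) (g_sym _ _ _).
Qed.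

(** The right-hand side of [koszul] sees the fields only through these three data at x, and pairing
    with tangent vectors determines a tangent vector. *)
Lemma nabla_ext X X' Y Y' x : vector_field X -> vector_field X' ->
  vector_field Y -> vector_field Y' -> on_M x -> X x = X' x -> Y x = Y' x ->
  'd Y x (X x) = 'd Y' x (X x) -> nabla X Y x = nabla X' Y' x.
Proof.
move=> vX vX' vY vY' Mx eX eY eD.
apply: (metric_nondegenerate Mx).
- exact: (nabla_vector_field LC vX vY).2.
- exact: (nabla_vector_field LC vX' vY').2.
move=> w tw; have vw := tangent_extension_vf w.
have two0 : (2 : R) != 0 by rewrite pnatr_eq0.
rewrite -(tangent_extensionE tw); apply: (mulfI two0).
apply: etrans (koszul vX vY vw Mx) (etrans _ (esym (koszul vX' vY' vw Mx))).
have cong d d' a a' b b' z : d = d' -> a = a' -> b = b' ->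
    2 * g x d z + dg x a b z + dg x b a z - dg x z a b =
    2 * g x d' z + dg x a' b' z + dg x b' a' z - dg x z a' b' by move=> -> -> ->.
exact: (cong _ _ _ _ _ _ _ (etrans eD (congr1 ('d Y' x) eX)) eX eY).
Qed.

Lemma nabla_local X Y Y' x : vector_field X -> vector_field Y -> vector_field Y' ->
  (forall z, on_M z -> Y z = Y' z) -> on_M x -> nabla X Y x = nabla X Y' x.
Proof.
move=> vX vY vY' YY' Mx; apply: (nabla_ext vX vX vY vY' Mx erefl (YY' _ Mx)).
exact: (dd_on_M YY' Mx (vX.2 _ Mx) (smooth_dd x _ vY.1) (smooth_dd x _ vY'.1)).
Qed.

(** Y may be nonzero off the submanifold, so locality first replaces it by the zero field;
    additivity then treats 0 + 0 = 0. *)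
Lemma nabla_eq0 X Y x : vector_field X -> vector_field Y ->
  (forall z, on_M z -> Y z = 0) -> on_M x -> nabla X Y x = 0.
Proof.
move=> vX vY Y0 Mx; have v0 : vector_field (fun _ : E => 0 : E).
  split=> [|z _]; first exact: smooth_cst.
  by split; rewrite dot0r.
rewrite (nabla_local vX vY v0 Y0 Mx).
have := nabla_addr LC vX v0 v0 Mx.
have -> : (fun z : E => (0 : E) + 0) = fun=> 0 by apply/funext => z; rewrite addr0.
by move=> /eqP; rewrite -[X in X == _]addr0 (inj_eq (addrI _)) => /eqP.
Qed.

Lemma nabla_const_scale X Y x a : vector_field X -> vector_field Y -> on_M x ->
  nabla X (fun z => a *: Y z) x = a *: nabla X Y x.
Proof.
move=> vX vY Mx.
rewrite (nabla_leibniz LC (f := fun=> a)) //; last exact: smooth_cst.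
by rewrite (dd_cst x (X x) a).2 scale0r add0r.
Qed.

(** Tangency of the bracket comes from the connection: it is a difference of two covariant
    derivatives, which are tangent. *)
Lemma lie_bracket_vf X Y : vector_field X -> vector_field Y ->
  vector_field (lie_bracket X Y).
Proof.
move=> vX vY; split.
  by apply: smooth_sub; apply: smooth_diff_along; (exact: vX.1 || exact: vY.1).
move=> x Mx; rewrite -(nabla_torsion_free LC) //; apply: tangentB.
- exact: (nabla_vector_field LC vX vY).2.
- exact: (nabla_vector_field LC vY vX).2.
Qed.

Lemma mixed_curvature_vf T U : vector_field T -> vector_field U ->
  vector_field (mixed_curvature nabla T U).
Proof.
move=> vT vU; have nv := nabla_vector_field LC.
exact: (vector_fieldB (vector_fieldB (nv _ _ vU (nv _ _ vT vT))
  (nv _ _ vT (nv _ _ vU vT))) (nv _ _ (lie_bracket_vf vU vT) vT)).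
Qed.

End Koszul.

(** * The explicit metric and the algebraic identities for T, F and S *)

Section Model.
Context {R : realType} {m : nat}.
Local Notation E := (ambient R m).
Implicit Types (x u v w : E).
Variables s p r h : R.
Local Notation w2 := (1 + r ^+ 2).
Local Notation q := (r * h).

(* With s = sqrt (A * C) / 2, the metric of the theorem is s^-2 times [form]: one
   has 1 - C / A = (1 + r^2)^-1 and D = 2 s / p. *)
Definition form x u v : R :=
  dot u.1 v.1 - w2^-1 * (dot x.1·j u.1 * dot x.1·j v.1) + p ^+ 2 * dot u.2 v.2
  + p ^+ 2 * (dot x.1·i u.1 * dot x.2·i v.2 + dot x.2·i u.2 * dot x.1·i v.1)
  + p * q * (dot x.1·k u.1 * dot x.2·i v.2 + dot x.2·i u.2 * dot x.1·k v.1).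

(* The derivative of [form] in the base point [x], in the direction [z]. *)
Definition dform x z u v : R :=
  - w2^-1 * (dot z.1·j u.1 * dot x.1·j v.1 + dot x.1·j u.1 * dot z.1·j v.1)
  + p ^+ 2 * (dot z.1·i u.1 * dot x.2·i v.2 + dot x.1·i u.1 * dot z.2·i v.2
              + dot z.2·i u.2 * dot x.1·i v.1 + dot x.2·i u.2 * dot z.1·i v.1)
  + p * q * (dot z.1·k u.1 * dot x.2·i v.2 + dot x.1·k u.1 * dot z.2·i v.2
              + dot z.2·i u.2 * dot x.1·k v.1 + dot x.2·i u.2 * dot z.1·k v.1).

Definition leaf x : E := (s *: x.1·i, 0).

(* The eigenvector F of the simple eigenvalue. *)
Definition axis x : E :=
  (s *: ((r * p) *: x.1·i + (h * w2) *: x.1·k), - (s * r / p) *: x.2·i).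

(* The tensor S; [dshape] is its derivative in the base point. *)
Definition shape x u : E :=
  let c := dot x.1·j u.1 / (h * w2) in let d := dot x.2·i u.2 in
  (s *: (u.1·i + dot x.1·i u.1 *: x.1 - (c * (r * p)) *: x.1·i
         - dot x.1·j u.1 *: x.1·k - (d * (p * h * w2 / r)) *: x.1·j),
   s *: (u.2·i + d *: x.2 + (c * (r / p)) *: x.2·i)).

Definition dshape x z u : E :=
  let c := dot x.1·j u.1 / (h * w2) in let c' := dot z.1·j u.1 / (h * w2) in
  let d := dot x.2·i u.2 in let d' := dot z.2·i u.2 in
  (s *: (dot z.1·i u.1 *: x.1 + dot x.1·i u.1 *: z.1
         - (c' * (r * p)) *: x.1·i - (c * (r * p)) *: z.1·i
         - (dot z.1·j u.1 *: x.1·k + dot x.1·j u.1 *: z.1·k)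
         - (d' * (p * h * w2 / r)) *: x.1·j - (d * (p * h * w2 / r)) *: z.1·j),
   s *: (d' *: x.2 + d *: z.2 + (c' * (r / p)) *: x.2·i + (c * (r / p)) *: z.2·i)).

Lemma form_linear x v : linear (fun u => form x u v : R^o).
Proof.
by move=> a u u'; rewrite /form /= !dot_lin -[a *: _]/(a * _); ring.
Qed.

Lemma formC x u v : form x u v = form x v u.
Proof. by rewrite /form (dotC u.1) (dotC u.2); ring. Qed.

Ltac dd_auto := repeat first
 [ eassumption | apply: dd_id | apply: dd_cst | apply: dd_fst | apply: dd_snd
 | apply: dd_hmul | apply: dd_pair | apply: dd_dot | apply: dd_sub
 | apply: dd_add | apply: dd_mul | apply: dd_scale ].

Lemma dd_form x v (X Y : E -> E) (a b : E) : has_dd x v X a -> has_dd x v Y b ->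
  has_dd x v (fun z => form z (X z) (Y z))
    (dform x v (X x) (Y x) + (form x a (Y x) + form x (X x) b)).
Proof.
move=> HX HY; rewrite /form; apply: dd_eq; first by dd_auto.
by rewrite /dform /form /=; ring.
Qed.

Hypotheses (r_gt0 : 0 < r) (h_gt0 : 0 < h) (p_gt0 : 0 < p) (s_gt0 : 0 < s).
Hypothesis p_h : p ^+ 2 = 1 - h ^+ 2 * w2.

Let w_gt0 : 0 < w2. Proof. by rewrite ltr_pwDl // exprn_ge0 // ltW. Qed.
Let r0 : r != 0. Proof. exact: lt0r_neq0. Qed.
Let h0 : h != 0. Proof. exact: lt0r_neq0. Qed.
Let p0 : p != 0. Proof. exact: lt0r_neq0. Qed.
Let w0 : w2 != 0. Proof. exact: lt0r_neq0. Qed.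

(** The flat derivative of T along u is [leaf u], because [leaf] is linear. The identity therefore
    says that S solves the Koszul equation for nabla_u T. *)
Lemma shape_koszul x u v : on_M x -> tangent x u -> tangent x v ->
  2 * form x (shape x u - leaf u) v =
  dform x u (leaf x) v + dform x (leaf x) u v - dform x v u (leaf x).
Proof.
case: x u v => x y [a b] [a' b'] [/= xx yy] [/= xa yb] [/= xa' yb'].
rewrite /form /dform /shape /leaf; normalize.
(* Each product with a unit is brought to a single order of its arguments, so that equal quantities
   become one atom for [field]. *)
rewrite !(dot_hmul_flip x a, dot_hmul_flip x a', dot_hmul_flip y b, dot_hmul_flip y b',
  dot_hmul_flip a' a, dot_hmul_flip b' b).
rewrite ?(dotC a x) ?(dotC a' x) ?(dotC b y) ?(dotC b' y) xx yy xa yb xa' yb'.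
by field: p_h; rewrite w0 h0 p0 r0.
Qed.

Lemma leaf_tangent x : tangent x (leaf x).
Proof. by split; rewrite /= !dot_lin // dot_hmul_self mulr0. Qed.

Lemma axis_tangent x : tangent x (axis x).
Proof. by split; rewrite /= !dot_lin !dot_hmul_self !mulr0 ?addr0 ?mulr0. Qed.

Lemma shape_tangent x u : on_M x -> tangent x u -> tangent x (shape x u).
Proof.
case: x u => x y [a b] [/= xx yy] [/= xa yb].
split; rewrite /= !dot_lin !dot_hmul_self !dot_hmul_skew ?xx ?yy; ring.
Qed.

Lemma shape_linear x : linear (shape x).
Proof.
move=> c u v; apply: pairP; rewrite /= !hmul_lin !dot_lin; apply/matrixP => i j;
  rewrite !mx_lin; ring.
Qed.

Lemma shape_leaf x : on_M x -> shape x (leaf x) = 0.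
Proof.
case: x => x y [/= xx yy]; apply: pairP; normalize; rewrite ?xx ?yy;
  apply/matrixP => i j; rewrite !mx_lin; ring.
Qed.

Lemma form_leaf x : on_M x -> form x (leaf x) (leaf x) = s ^+ 2.
Proof.
case: x => x y [/= xx yy].
rewrite /form; normalize; rewrite xx; ring.
Qed.

Lemma form_axis_leaf x : on_M x -> form x (axis x) (leaf x) = 0.
Proof.
case: x => x y [/= xx yy].
rewrite /form; normalize; rewrite xx ?yy.
by field: p_h; rewrite w0 p0.
Qed.

Lemma form_axis x : on_M x -> form x (axis x) (axis x) = s ^+ 2 * (h ^+ 2 * w2).
Proof.
case: x => x y [/= xx yy].
rewrite /form; normalize; rewrite xx ?yy.
by field: p_h; rewrite w0 p0.
Qed.

(** The left-hand side is nabla_T F written as L_T F + S F, the bracket being explicit because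
    [axis] and [leaf] are both linear in the base point. *)
Lemma axis_parallel x : on_M x ->
  axis (leaf x) - leaf (axis x) + shape x (axis x) = 0.
Proof.
case: x => x y [/= xx yy].
by apply: pairP; normalize; rewrite ?xx ?yy; apply/matrixP => i j;
  rewrite !mx_lin; field: p_h; rewrite ?w0 ?p0 ?h0 ?r0.
Qed.

Lemma dd_shape x v (X : E -> E) (a : E) : has_dd x v X a ->
  has_dd x v (fun z => shape z (X z)) (dshape x v (X x) + shape x a).
Proof.
move=> HX; rewrite /shape; apply: dd_eq; first by dd_auto.
by apply: pairP; rewrite /=; apply/matrixP => i j; rewrite !mx_lin; ring.
Qed.

(* The left-hand side is - L_T S - S^2, since [leaf] is linear. *)
Lemma shape_riccati x u : on_M x -> tangent x u ->
  leaf (shape x u) - dshape x (leaf x) u - shape x (leaf u) - shape x (shape x u) =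
  s ^+ 2 *: u - form x u (leaf x) *: leaf x
  + (3 / (h ^+ 2 * w2) * form x u (axis x)) *: axis x.
Proof.
case: x u => x y [a b] [/= xx yy] [/= xa yb].
have xa' := etrans (dotC a x) xa; have yb' := etrans (dotC b y) yb.
by apply: pairP; rewrite /form; normalize;
  rewrite ?(dot_hmul_flip x a, dot_hmul_flip y b) ?xa' ?yb' ?xa ?yb xx ?yy;
  apply/matrixP => i j; rewrite !mx_lin; field: p_h; rewrite ?w0 ?p0 ?h0 ?r0.
Qed.

(** Positivity holds on the whole ambient space at x, beyond the tangent space: the form is a sum of
    squares whose simultaneous vanishing forces u = 0. *)
Lemma form_pos x u : on_M x -> u != 0 -> 0 < form x u u.
Proof.
case: x u => x y [a b] [/= xx yy]; apply: contraNT; rewrite -leNgt => le0.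
pose a1 := dot x·i a; pose a2 := dot x·j a; pose a3 := dot x·k a.
pose b1 := dot y·i b.
pose ah := a - a1 *: x·i - a2 *: x·j - a3 *: x·k; pose bh := b - b1 *: y·i.
have eah : dot ah ah = dot a a - a1 ^+ 2 - a2 ^+ 2 - a3 ^+ 2.
  rewrite /ah !dot_lin !(dotC a) -/a1 -/a2 -/a3.
  rewrite !dot_hmul_skew !hmul_lin !dot_lin !dot_hmul_self xx; ring.
have ebh : dot bh bh = dot b b - b1 ^+ 2.
  rewrite /bh !dot_lin !(dotC b) -/b1 !dot_hmul_skew !hmul_lin !dot_lin yy; ring.
(* Completing squares in a1 and a3 leaves p^2 (1 - p^2 - q^2) b1^2 = (p h b1)^2, and a2 keeps the
   coefficient 1 - 1 / (1 + r^2). *)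
have e : form (x, y) (a, b) (a, b) = dot ah ah + p ^+ 2 * dot bh bh
    + r ^+ 2 / w2 * a2 ^+ 2 + (a1 + p ^+ 2 * b1) ^+ 2 + (a3 + p * q * b1) ^+ 2
    + (p * h * b1) ^+ 2.
  rewrite eah ebh /form /= -/a1 -/a2 -/a3 -/b1.
  by field: p_h; rewrite w0.
have p2 : 0 < p ^+ 2 by rewrite exprn_gt0.
have rw : 0 < r ^+ 2 / w2 by rewrite divr_gt0 // exprn_gt0.
have t1 := dot_ge0 ah; have t2 : 0 <= p ^+ 2 * dot bh bh.
  by rewrite mulr_ge0 ?dot_ge0 // ltW.
have t3 : 0 <= r ^+ 2 / w2 * a2 ^+ 2 by rewrite mulr_ge0 ?sqr_ge0 // ltW.
have t4 := sqr_ge0 (a1 + p ^+ 2 * b1); have t5 := sqr_ge0 (a3 + p * q * b1).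
have t6 := sqr_ge0 (p * h * b1); rewrite e in le0.
have /eqP : (p * h * b1) ^+ 2 = 0 by lra.
rewrite sqrf_eq0 !mulf_eq0 (negPf p0) (negPf h0) /= => /eqP b10.
have /eqP : (a1 + p ^+ 2 * b1) ^+ 2 = 0 by lra.
rewrite b10 mulr0 addr0 sqrf_eq0 => /eqP a10.
have /eqP : (a3 + p * q * b1) ^+ 2 = 0 by lra.
rewrite b10 mulr0 addr0 sqrf_eq0 => /eqP a30.
have /eqP : r ^+ 2 / w2 * a2 ^+ 2 = 0 by lra.
rewrite mulf_eq0 gt_eqF //= sqrf_eq0 => /eqP a20.
have /eqP : p ^+ 2 * dot bh bh = 0 by lra.
rewrite mulf_eq0 gt_eqF //= dot_eq0 /bh b10 scale0r subr0 => /eqP ->.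
have /eqP : dot ah ah = 0 by lra.
by rewrite dot_eq0 /ah a10 a20 a30 !scale0r !subr0 => /eqP ->.
Qed.

Ltac smooth_auto := repeat first
 [ eassumption | apply: smooth_id | apply: smooth_cst | apply: smooth_fst
 | apply: smooth_snd | apply: smooth_hmul | apply: smooth_pair | apply: smooth_dot
 | apply: smooth_sub | apply: smooth_add | apply: smooth_mul
 | apply: smooth_scale ].

Lemma smooth_form (X Y : E -> E) :
  smooth X -> smooth Y -> smooth (fun x => form x (X x) (Y x)).
Proof. by move=> sX sY; rewrite /form; smooth_auto. Qed.

Lemma leaf_vf : vector_field leaf.
Proof. by split=> [|x _]; [rewrite /leaf; smooth_auto|exact: leaf_tangent]. Qed.

Lemma axis_vf : vector_field axis.
Proof. by split=> [|x _]; [rewrite /axis; smooth_auto|exact: axis_tangent]. Qed.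

Lemma dd_leaf x v : has_dd x v leaf (leaf v).
Proof.
rewrite /leaf; apply: dd_eq; first by dd_auto.
by congr pair; rewrite scale0r add0r.
Qed.

Lemma dd_axis x v : has_dd x v axis (axis v).
Proof.
rewrite /axis; apply: dd_eq; first by dd_auto.
by congr pair; rewrite !scale0r !add0r.
Qed.

Definition metric x u v : R := s ^- 2 * form x u v.

Definition dmetric x z u v : R := s ^- 2 * dform x z u v.

Let s0 : s != 0. Proof. exact: lt0r_neq0. Qed.

Lemma metric_linear_l x v : linear (fun u => metric x u v : R^o).
Proof. by move=> c u u'; rewrite /metric form_linear mulrDr scalerAr. Qed.

Lemma metricC x u v : metric x u v = metric x v u.
Proof. by rewrite /metric formC. Qed.

Lemma metric_gt0 x u : on_M x -> u != 0 -> 0 < metric x u u.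
Proof. by move=> Mx u0; rewrite mulr_gt0 ?form_pos // invr_gt0 exprn_gt0. Qed.

Lemma dd_metric x v (X Y : E -> E) (a b : E) : has_dd x v X a -> has_dd x v Y b ->
  has_dd x v (fun z => metric z (X z) (Y z))
    (dmetric x v (X x) (Y x) + (metric x a (Y x) + metric x (X x) b)).
Proof.
move=> HX HY; rewrite /metric.
apply: dd_eq; first by apply: dd_mul; [exact: dd_cst|exact: (dd_form HX HY)].
by rewrite /dmetric mul0r add0r !mulrDr.
Qed.

Lemma metric_riemannian : riemannian_metric metric.
Proof.
split=> [x a u v w _ _ _ _|x u v _ _ _|x u Mx _|X Y vX vY].
- exact: metric_linear_l.
- exact: metricC.
- exact: metric_gt0.
- apply: smooth_mul; first exact: smooth_cst.
  by apply: smooth_form; [exact: vX.1|exact: vY.1].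
Qed.

Let mDl := bilDl metric_linear_l.
Let mZl := bilZl metric_linear_l.
Let mNl := bilNl metric_linear_l.

Lemma metric_leaf x : on_M x -> metric x (leaf x) (leaf x) = 1.
Proof. by move=> Mx; rewrite /metric form_leaf // mulVf // expf_neq0. Qed.

Lemma metric_axis_leaf x : on_M x -> metric x (axis x) (leaf x) = 0.
Proof. by move=> Mx; rewrite /metric form_axis_leaf // mulr0. Qed.

Lemma metric_axis x : on_M x -> metric x (axis x) (axis x) = h ^+ 2 * w2.
Proof. by move=> Mx; rewrite /metric form_axis // mulKf // expf_neq0. Qed.

(** A linear extension of R_T to the ambient space. It agrees with R_T on normal vectors but sends T
    to s^2 T, whereas R(T, T)T = 0. *)
Definition curv x u : E :=
  s ^+ 2 *: u + (3 * s ^+ 2 / (h ^+ 2 * w2) * metric x u (axis x)) *: axis x.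

(** * Covariant derivatives along the leaves and the mixed curvature *)

Section Connection.
Variable nabla : (E -> E) -> (E -> E) -> (E -> E).
Hypothesis LC : levi_civita metric nabla.
Let nvf := nabla_vector_field LC.

Lemma nabla_leaf U x : vector_field U -> on_M x -> nabla U leaf x = shape x (U x).
Proof.
move=> vU Mx; have tU := vU.2 x Mx.
apply: (metric_nondegenerate metric_linear_l metric_gt0 Mx).
- exact: (nvf vU leaf_vf).2.
- exact: shape_tangent.
move=> w tw; have vw := tangent_extension_vf w.
have := koszul metric_linear_l metricC dd_metric LC vU leaf_vf vw Mx.
rewrite (tangent_extensionE tw) (dd_leaf x (U x)).2 /dmetric.
have := shape_koszul Mx tU tw.
have -> : form x (shape x (U x) - leaf (U x)) w =
    s ^+ 2 * (metric x (shape x (U x)) w - metric x (leaf (U x)) w).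
  by rewrite -mNl -mDl /metric mulVKf // expf_neq0.
move=> e1 e2; apply: (@mulfI _ 2); first by rewrite pnatr_eq0.
move: e1 => /(congr1 (fun c =>
  c + dform x w (U x) (leaf x) - dform x (leaf x) (U x) w)).
by rewrite e2 subrK addrK => <-; field.
Qed.

Lemma nabla_leaf_leaf x : on_M x -> nabla leaf leaf x = 0.
Proof. by move=> Mx; rewrite nabla_leaf ?shape_leaf //; exact: leaf_vf. Qed.

Lemma nabla_along_leaf W x : vector_field W -> on_M x ->
  nabla leaf W x = 'd W x (leaf x) - leaf (W x) + shape x (W x).
Proof.
move=> vW Mx; rewrite -(nabla_leaf vW Mx).
have torsion := etrans (nabla_torsion_free LC leaf_vf vW Mx)
  (congr1 (fun z => 'd W x (leaf x) - z) (dd_leaf x (W x)).2).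
exact: etrans (esym (subrK _ _)) (congr1 (fun z => z + nabla W leaf x) torsion).
Qed.

Lemma nabla_leaf_axis x : on_M x -> nabla leaf axis x = 0.
Proof.
move=> Mx; apply: etrans (nabla_along_leaf axis_vf Mx) _.
apply: etrans (axis_parallel Mx).
exact: (congr1 (fun z => z - leaf (axis x) + shape x (axis x))
  (dd_axis x (leaf x)).2).
Qed.

(** The T-term corrects [curv] so that the formula covers every vector field, normal or not; it
    vanishes on normal ones. *)
Lemma mixed_curvatureE U x : vector_field U -> on_M x ->
  mixed_curvature nabla leaf U x =
  curv x (U x) - (s ^+ 2 * metric x (U x) (leaf x)) *: leaf x.
Proof.
move=> vU Mx; have tU := vU.2 x Mx.
have vB := lie_bracket_vf LC vU leaf_vf.
have vUT := nvf vU leaf_vf.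
rewrite /mixed_curvature /curvature.
(* The field nabla_T T is known to vanish only on the submanifold, which still gives nabla_U
   (nabla_T T) = 0 there. *)
rewrite (nabla_eq0 metric_linear_l metricC metric_gt0 dd_metric LC vU
  (nvf leaf_vf leaf_vf) nabla_leaf_leaf Mx).
rewrite (nabla_along_leaf vUT Mx) (nabla_leaf vB Mx) (nabla_leaf vU Mx).
(* Likewise nabla_U T equals S U only on the submanifold; T is tangent, so the derivatives of both
   sides along T agree. *)
have -> : 'd (nabla U leaf) x (leaf x) =
    dshape x (leaf x) (U x) + shape x ('d U x (leaf x)).
  exact: (dd_on_M (fun z Mz => nabla_leaf vU Mz) Mx (leaf_tangent x)
    (smooth_dd x _ vUT.1) (dd_shape (smooth_dd x (leaf x) vU.1))).
rewrite [lie_bracket U leaf x](congr1 (fun z => z - 'd U x (leaf x))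
  (dd_leaf x (U x)).2).
pose SM := GRing.isLinear.Build _ _ _ _ _ (shape_linear x).
pose SL : {linear E -> E} := HB.pack (shape x) SM.
have -> : shape x (leaf (U x) - 'd U x (leaf x)) =
    shape x (leaf (U x)) - shape x ('d U x (leaf x)).
  exact: (linearB SL).
have := shape_riccati Mx tU.
(* This is the only remaining trace of the derivative of U. It enters once from nabla_T (S U) and
   once from S [U, T], with opposite signs, and cancels. *)
set dU := shape x ('d U x (leaf x)).
have -> : curv x (U x) - (s ^+ 2 * metric x (U x) (leaf x)) *: leaf x =
    s ^+ 2 *: U x - form x (U x) (leaf x) *: leaf x
    + (3 / (h ^+ 2 * w2) * form x (U x) (axis x)) *: axis x.
  rewrite /curv /metric addrAC mulVKf ?expf_neq0 //; congr (_ - _ + _ *: _).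
  by field; rewrite s0 h0 w0.
move=> <-; rewrite {}/dU.
move: (leaf (shape x (U x))) (dshape x (leaf x) (U x)) (shape x (leaf (U x)))
  (shape x (shape x (U x))) (shape x ('d U x (leaf x))) => a b c d dU.
by apply: pairP; apply/matrixP => i j; rewrite /= !mx_lin; ring.
Qed.

Lemma diff_metric_along_leaf U V x : vector_field U -> vector_field V -> on_M x ->
  nabla leaf V x = 0 ->
  'd (fun z => metric z (U z) (V z)) x (leaf x) = metric x (nabla leaf U x) (V x).
Proof.
move=> vU vV Mx V0; apply: etrans (nabla_metric LC leaf_vf vU vV Mx) _.
by rewrite V0 (metricC x (U x)) -(scale0r (0 : E)) mZl mul0r addr0.
Qed.

Lemma curv_normal x u : on_M x -> normal metric leaf x u ->
  normal metric leaf x (curv x u).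
Proof.
move=> Mx [tu uT]; split.
  by apply: tangentD; apply: tangentZ => //; exact: axis_tangent.
by rewrite mDl !mZl uT metric_axis_leaf // !mulr0 addr0.
Qed.

Lemma normal_nabla_normal U : normal_field metric leaf U ->
  normal_field metric leaf (normal_nabla metric nabla leaf U).
Proof.
move=> [vU nU]; have vn := nvf leaf_vf vU; split.
  apply: (vector_fieldB vn); apply: vector_fieldZ; last exact: leaf_vf.
  by apply: (metric_smooth metric_riemannian) => //; exact: leaf_vf.
move=> x Mx; split.
  by apply: tangentB; [exact: vn.2|exact/tangentZ/leaf_tangent].
by rewrite /normal_nabla mDl mNl mZl metric_leaf // mulr1 subrr.
Qed.

(** Since nabla_T F = 0, only the coefficient g(U, F) is differentiated, and metric compatibility
    gives g(nabla_T U, F). *)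
Lemma curv_parallel U x : normal_field metric leaf U -> on_M x ->
  nabla leaf (fun z => curv z (U z)) x = curv x (nabla leaf U x).
Proof.
move=> [vU nU] Mx; rewrite /curv.
set c := 3 * s ^+ 2 / (h ^+ 2 * w2).
have sUF : smooth (fun z => metric z (U z) (axis z)).
  by apply: (metric_smooth metric_riemannian) => //; exact: axis_vf.
have sc : smooth (fun z => c * metric z (U z) (axis z)).
  by apply: smooth_mul => //; exact: smooth_cst.
have v1 : vector_field (fun z => s ^+ 2 *: U z).
  by apply: vector_fieldZ => //; exact: smooth_cst.
have v2 := vector_fieldZ sc axis_vf.
apply: etrans (nabla_addr LC leaf_vf v1 v2 Mx) _; congr (_ + _).
  exact: (nabla_const_scale LC _ leaf_vf vU Mx).
apply: etrans (nabla_leibniz LC sc leaf_vf axis_vf Mx) _.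
rewrite (nabla_leaf_axis Mx) scaler0 addr0; congr (_ *: _).
apply: etrans (dd_mul (dd_cst x (leaf x) c) (smooth_dd x (leaf x) sUF)).2 _.
by rewrite mul0r add0r (diff_metric_along_leaf vU axis_vf Mx (nabla_leaf_axis Mx)).
Qed.

Lemma curvature_parallel U x : normal_field metric leaf U -> on_M x ->
  normal_derivative metric nabla leaf U x = 0.
Proof.
move=> nU Mx; have [vU oU] := nU; have nN := normal_nabla_normal nU.
have vR := mixed_curvature_vf LC leaf_vf vU.
have vK : vector_field (fun z => curv z (U z)).
  apply: vector_fieldD; apply: vector_fieldZ => //; try exact: smooth_cst.
  - apply: smooth_mul; first exact: smooth_cst.
    by apply: (metric_smooth metric_riemannian) => //; exact: axis_vf.
  - exact: axis_vf.
have RK z : on_M z -> mixed_curvature nabla leaf U z = curv z (U z).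
  by move=> Mz; rewrite mixed_curvatureE // (oU z Mz).2 mulr0 scale0r subr0.
rewrite /normal_derivative (mixed_curvatureE nN.1 Mx) (nN.2 x Mx).2.
rewrite mulr0 scale0r subr0.
rewrite /normal_nabla (nabla_local metric_linear_l metricC metric_gt0 dd_metric LC
  leaf_vf vR vK RK Mx).
rewrite (curv_parallel nU Mx); move: (nabla leaf U x) => v.
(* Only multiples of T are left to compare. As F is orthogonal to T, both the T-part of [curv x v]
   and the image under [curv] of the T-part of v equal s^2 g(v, T) T. *)
rewrite /curv !mDl !mZl !mNl !mZl metric_axis_leaf // (metricC x (leaf x)).
rewrite metric_axis_leaf //.
rewrite !mulr0 addr0 subr0.
by apply: pairP; apply/matrixP => i j; rewrite !mx_lin; ring.
Qed.

End Connection.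

(** * Positivity, eigenvalues and multiplicities *)

Lemma curv_linear x : linear (curv x).
Proof.
move=> c u v; rewrite /curv mDl mZl.
by apply: pairP; apply/matrixP => i j; rewrite !mx_lin; ring.
Qed.

Let n0 : h ^+ 2 * w2 != 0. Proof. by rewrite mulf_neq0 // expf_neq0. Qed.

Lemma metric0l x v : metric x 0 v = 0.
Proof. by rewrite -[X in metric x X v](scale0r (0 : E)) mZl mul0r. Qed.

Lemma axis_neq0 x : on_M x -> axis x != 0.
Proof.
move=> Mx; apply: contra_neq n0 => F0.
by rewrite -(metric_axis Mx) {1}F0 metric0l.
Qed.

Lemma axis_normal x : on_M x -> normal metric leaf x (axis x).
Proof. by move=> Mx; split; [exact: axis_tangent|exact: metric_axis_leaf]. Qed.

Lemma curv_axis x : on_M x -> curv x (axis x) = (4 * s ^+ 2) *: axis x.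
Proof.
move=> Mx; rewrite /curv metric_axis // -scalerDl; congr (_ *: _).
by field; rewrite h0 w0.
Qed.

Lemma metric_curv_axis x u : on_M x ->
  metric x (curv x u) (axis x) = 4 * s ^+ 2 * metric x u (axis x).
Proof.
by move=> Mx; rewrite /curv mDl !mZl metric_axis //; field; rewrite h0 w0.
Qed.

Lemma metric_curv_gt0 x u : on_M x -> u != 0 -> 0 < metric x (curv x u) u.
Proof.
move=> Mx u0; rewrite /curv mDl !mZl (metricC x (axis x)) -mulrA -expr2.
rewrite ltr_pwDl //; first by rewrite mulr_gt0 ?exprn_gt0 ?metric_gt0.
by rewrite mulr_ge0 ?sqr_ge0 // divr_ge0 ?mulr_ge0 ?sqr_ge0 // ltW.
Qed.

(** An unnormalized u_2, the witness for the eigenvalue s^2: it is orthogonal to both T and F and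
    never vanishes on the submanifold. *)
Definition u2 x : E := (x.1·j, 0).

Lemma u2_neq0 x : on_M x -> u2 x != 0.
Proof.
move=> [xx _]; apply/eqP => /(congr1 fst) /= j0; move: (oner_neq0 R).
by rewrite -xx -[dot _ _]opprK -dotNr -(hmul_units x.1).1.1.1.1.2 -!dot_hmul_skew
  j0 dot0l eqxx.
Qed.

Lemma u2_normal x : on_M x -> normal metric leaf x (u2 x).
Proof.
case: x => x y [/= xx yy]; split.
  by split; rewrite /= ?dot_hmul_self ?dot0r.
rewrite /metric /form; normalize; ring.
Qed.

Lemma metric_u2_axis x : on_M x -> metric x (u2 x) (axis x) = 0.
Proof.
case: x => x y [/= xx yy].
rewrite /metric /form; normalize; ring.
Qed.

Lemma curv_orth_axis x u : metric x u (axis x) = 0 -> curv x u = s ^+ 2 *: u.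
Proof. by move=> e; rewrite /curv e mulr0 scale0r addr0. Qed.

(** Pairing the eigenvalue equation with F gives a g(u, F) = 4 s^2 g(u, F). If g(u, F) = 0, the
    rank-one part of [curv] drops out instead. *)
Lemma curv_eigenvector x u a : on_M x -> u != 0 -> curv x u = a *: u ->
  a = s ^+ 2 /\ metric x u (axis x) = 0 \/ a = 4 * s ^+ 2.
Proof.
move=> Mx u0 Ku; have [uF|uF] := eqVneq (metric x u (axis x)) 0; [left|right].
  split=> //; apply/eqP; rewrite -subr_eq0.
  have /eqP := Ku; rewrite curv_orth_axis // eq_sym -subr_eq0 -scalerBl scaler_eq0.
  by rewrite (negPf u0) orbF.
by apply: (mulIf uF); rewrite -metric_curv_axis // Ku mZl.
Qed.

Lemma s2_neq : s ^+ 2 != 4 * s ^+ 2.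
Proof. by apply/eqP => e; have := exprn_gt0 2 s_gt0; lra. Qed.

Section Spectrum.
Variables (x : E) (k : 'End(E)).
Hypotheses (Mx : on_M x) (kE : forall u, k u = curv x u).

Lemma curv_nonscalar :
  ~ exists c : R, forall u, normal metric leaf x u -> k u = c *: u.
Proof.
move=> [c kc]; have := kc _ (u2_normal Mx); have := kc _ (axis_normal Mx).
rewrite !kE => /(curv_eigenvector Mx (axis_neq0 Mx)) [[_]|->].
  by rewrite metric_axis // => /eqP; rewrite (negPf n0).
rewrite curv_orth_axis ?metric_u2_axis // => /eqP; rewrite -subr_eq0 -scalerBl.
by rewrite scaler_eq0 (negPf (u2_neq0 Mx)) orbF subr_eq0 (negPf s2_neq).
Qed.

Lemma curv_spectrum a :
  eigenvalue_on (normal metric leaf x) k a <-> a = s ^+ 2 \/ a = 4 * s ^+ 2.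
Proof.
split=> [[u [nu u0]]|[]->].
- by rewrite kE => /(curv_eigenvector Mx u0) [[->]|->]; [left|right].
- exists (u2 x); split; [exact: u2_normal|exact: u2_neq0|].
  by rewrite kE curv_orth_axis // metric_u2_axis.
- exists (axis x); split; [exact: axis_normal|exact: axis_neq0|].
  by rewrite kE curv_axis.
Qed.

Lemma curv_simple : eigenspace_dim (normal metric leaf x) k (4 * s ^+ 2) 1.
Proof.
exists <[axis x]>%VS; split; last by rewrite dim_vline axis_neq0.
move=> u; split=> [/vlineP[c ->]|[nu]].
  split; last by rewrite linearZ /= kE curv_axis // !scalerA mulrC.
  split; first exact/tangentZ/axis_tangent.
  by rewrite mZl metric_axis_leaf // mulr0.
rewrite kE /curv => e; apply/vlineP.
exists (metric x u (axis x) / (h ^+ 2 * w2)).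
(* Subtracting s^2 u from the eigenvalue equation leaves 3 s^2 u as a multiple of F. *)
have s3 : 3 * s ^+ 2 != 0 by rewrite mulf_neq0 // ?expf_neq0 // pnatr_eq0.
apply: (scalerI s3); rewrite scalerA.
have -> : (3 * s ^+ 2) *: u = (4 * s ^+ 2) *: u - s ^+ 2 *: u.
  by rewrite -scalerBl; congr (_ *: _); ring.
by rewrite -e addrC addKr; congr (_ *: _); field; rewrite h0 w0.
Qed.

(** The four linear conditions that cut the eigenspace of s^2 out of the ambient space: two for
    tangency, one each for orthogonality to T and to F. Here [quat] only packs four reals into a
    row. *)
Definition constraints (u : E) : 'rV[R]_4 :=
  quat (dot x.1 u.1) (dot x.2 u.2) (metric x u (leaf x)) (metric x u (axis x)).

Lemma constraints_linear : linear constraints.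
Proof.
move=> c u v; apply/rowP; elim/ord4P; rewrite !mx_lin !quatE /= ?dotDr ?dotZr //;
  by rewrite mDl mZl.
Qed.

Lemma constraints_surjective z : exists u, constraints u = z.
Proof.
pose e1 : E := (x.1, 0); pose e2 : E := (0, x.2).
have [xx yy] := Mx.
pose w := z 0 0 *: e1 + z 0 1 *: e2.
(* The system is triangular: T and F do not affect the tangency conditions, so they can absorb
   whatever w contributes to the last two entries. *)
pose c := z 0 2%:R - metric x w (leaf x); pose d := z 0 3%:R - metric x w (axis x).
exists (w + (c *: leaf x + (d / (h ^+ 2 * w2)) *: axis x)).
apply/rowP; elim/ord4P; rewrite quatE.
- by rewrite /w /= !dot_lin !dot_hmul_self xx; ring.
- by rewrite /w /= !dot_lin !dot_hmul_self yy; ring.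
- rewrite mDl (mDl _ (c *: leaf x)) !mZl metric_leaf // metric_axis_leaf //.
  by rewrite /c; ring.
- rewrite mDl (mDl _ (c *: leaf x)) !mZl metric_axis // (metricC x (leaf x)).
  rewrite metric_axis_leaf //.
  by rewrite /d; field; rewrite h0 w0.
Qed.

(** Rank-nullity: four independent conditions on an ambient space of dimension 4 m + 4. *)
Lemma curv_multiplicity : eigenspace_dim (normal metric leaf x) k (s ^+ 2) (4 * m).
Proof.
pose LM := GRing.isLinear.Build _ _ _ _ _ constraints_linear.
pose L : {linear E -> 'rV[R]_4} := HB.pack constraints LM.
exists (lker (linfun L)); split=> [u|].
  rewrite memv_ker lfunE /=; split=> [/eqP/rowP e|[[[t1 t2] nT]]].
    have := (e 0, e 1, e 2%:R, e 3%:R); rewrite !quatE !mxE => -[[[t1 t2] nT] nF].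
    by rewrite kE curv_orth_axis.
  rewrite kE => Ku; have [->|u0] := eqVneq u 0; first exact/eqP/(linear0 L).
  have [[_ uF]|/eqP] := curv_eigenvector Mx u0 Ku; last by rewrite (negPf s2_neq).
  by apply/eqP/rowP; elim/ord4P; rewrite quatE mxE.
have := limg_ker_dim (linfun L) fullv.
have -> : limg (linfun L) = fullv.
  apply/eqP; rewrite eqEsubv subvf /=; apply/subvP => z _.
  have [u <-] := constraints_surjective z.
  rewrite -[constraints u](lfunE L u); exact/memv_img/memvf.
rewrite capfv !dimvf dim_matrix [X in _ = X -> _](_ : _ = m * 4 + 1 * 4)%N //.
by move=> /addIn ->; rewrite mulnC.
Qed.
End Spectrum.

End Model.

(** * Identification with the metric of the statement *)

(** Writing sqrt (A * C) as 2 s and C as 4 s^2 / A makes both sides rational in A, s and p. The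
    ratio M^2 / L^2 is C / A, which is 1 - (1 + r^2)^-1. *)
Lemma g_totalE (R : realType) m (A C p : R) : 0 < C -> C < A -> 0 < p ->
  let s := Num.sqrt (A * C) / 2 in let r := Num.sqrt (C / (A - C)) in
  forall h, @g_total R m A C p (r * h) (Num.sqrt (A * C) / p) = metric s p r h.
Proof.
move=> C0 CA p0 s r h.
have A0 : 0 < A by exact: lt_trans CA.
have AC0 : 0 < A * C by rewrite mulr_gt0.
have s0 : 0 < s by rewrite divr_gt0 // sqrtr_gt0.
have ss : A * C = 4 * s ^+ 2.
  by rewrite /s exprMn sqr_sqrtr ?ltW //; field.
have rr : r ^+ 2 = C / (A - C) by rewrite sqr_sqrtr // divr_ge0 ?subr_ge0 // ltW.
have CE : C = 4 * s ^+ 2 / A by rewrite -ss mulrC mulKf ?gt_eqF.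
have wE : (1 + r ^+ 2)^-1 = 1 - 4 * s ^+ 2 / A ^+ 2.
  rewrite rr; have d0 : A - C != 0 by rewrite gt_eqF // subr_gt0.
  have -> : 1 + C / (A - C) = A / (A - C) by field.
  by rewrite invf_div {1}CE; field; rewrite gt_eqF.
have -> : Num.sqrt (A * C) = 2 * s by rewrite /s; field.
apply/funext => -[x y]; apply/funext => -[a b]; apply/funext => -[a' b'].
rewrite /metric /form wE /g_total /beta1 /beta3 /sigma1 /gS3 /v1 /gAC /eta2 /u1 /u3.
rewrite /xi1 /xi2 /xi3 /Lc /Mc !qmul_hmul /=.
have -> : Num.sqrt (A * C) = 2 * s by rewrite /s; field.
rewrite !dot_lin !dot_hmul_skew !hmul_lin !dot_lin !dot_hmul_self.
by field; rewrite !gt_eqF.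
Qed.

Theorem proposition4p4 (R : realType) (m : nat) (A C p : R) :
  (1 <= m)%N -> 0 < C -> C < A -> 0 < p < 1 ->
  let r := Num.sqrt (C / (A - C)) in
  let h := Num.sqrt ((1 - p ^+ 2) / (1 + r ^+ 2)) in
  let q := r * h in
  let D := Num.sqrt (A * C) / p in
  let g := @g_total R m A C p q D in
  let T := @T_field R m A C in
  [/\ p != 0, q != 0, p ^+ 2 + q ^+ 2 < 1, riemannian_metric g &
    forall nabla, levi_civita g nabla ->
      (forall U, normal_field g T U ->
         forall x, on_M x -> normal_derivative g nabla T U x = 0) /\
      (forall x, on_M x ->
         exists2 K : 'End(ambient R m), mixed_curvature_at g nabla T x K &
         [/\ (forall u, normal g T x u -> u != 0 -> 0 < g x (K u) u),
             ~ (exists c : R, forall u, normal g T x u -> K u = c *: u),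
             (forall a : R, eigenvalue_on (normal g T x) K a <->
                            a = A * C / 4 \/ a = A * C),
             eigenspace_dim (normal g T x) K (A * C) 1 &
             eigenspace_dim (normal g T x) K (A * C / 4) (4 * m)%N])].
Proof.
move=> _ C0 CA /andP[p_gt0 p1] r h q D g T'.
have A0 : 0 < A by exact: lt_trans CA.
have AC0 : 0 < A * C by rewrite mulr_gt0.
pose s := Num.sqrt (A * C) / 2.
have s_gt0 : 0 < s by rewrite divr_gt0 // sqrtr_gt0.
have r_gt0 : 0 < r by rewrite sqrtr_gt0 divr_gt0 // subr_gt0.
have w_gt0 : 0 < 1 + r ^+ 2 by rewrite ltr_pwDl // sqr_ge0.
have p2 : 0 < 1 - p ^+ 2 by rewrite subr_gt0 expr_lt1 // ltW.
have h_gt0 : 0 < h by rewrite sqrtr_gt0 divr_gt0.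
have p_h : p ^+ 2 = 1 - h ^+ 2 * (1 + r ^+ 2).
  by rewrite sqr_sqrtr ?divrK ?unitfE ?gt_eqF ?subKr // divr_ge0 // ltW.
have sE : A * C / 4 = s ^+ 2 by rewrite exprMn sqr_sqrtr ?ltW //; field.
have s4E : A * C = 4 * s ^+ 2 by rewrite -sE; field.
have gE : g = metric s p r h by exact: g_totalE.
have TE : T' = leaf s by [].
rewrite {}TE {}gE sE s4E; split.
- exact: lt0r_neq0.
- by rewrite mulf_neq0 ?lt0r_neq0.
(* By [p_h] the sum p^2 + q^2 is 1 - h^2. *)
- by rewrite p_h /q exprMn; have := exprn_gt0 2 h_gt0; lra.
- exact: metric_riemannian.
move=> nabla LC; split=> [U nU x Mx|x Mx]; first exact: curvature_parallel.
pose KM := GRing.isLinear.Build _ _ _ _ _ (curv_linear s p r h x).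
pose KL : {linear ambient R m -> ambient R m} := HB.pack (curv s p r h x) KM.
have kE u : linfun KL u = curv s p r h x u by rewrite lfunE.
exists (linfun KL).
  split=> [u nu|U nU]; first by rewrite kE; exact: curv_normal.
  rewrite kE (mixed_curvatureE r_gt0 h_gt0 p_gt0 s_gt0 p_h LC nU.1 Mx).
  by rewrite (nU.2 x Mx).2 mulr0 scale0r subr0.
split.
- by move=> u _ u0; rewrite kE; exact: metric_curv_gt0.
- exact: curv_nonscalar.
- exact: curv_spectrum.
- exact: curv_simple.
- exact: curv_multiplicity.
Qed.
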